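(* For every $n\ge 1$, the poset $B_n(312,\overline{312},2\overline{1},\overline{2}1)$ (with the partial order $\le$ transported from Grand-Dyck paths described in the context) is isomorphic to the set $\hat{S}_{\pm n}[312,\overline{312},2\overline{1},\overline{2}1]$ endowed with the (strong) Bruhat order induced from the symmetric group $S_{\pm n}$.
   Context: Signed permutations. $B_n$ is the set of all signed permutations $\pi=\pi_1\cdots\pi_n$, i.e. permutations of $\{1,\ldots,n\}$ in which each entry may carry a sign, denoted by an overline ($\overline{k}$ is identified with $-k$, and $\overline{\overline{k}}=k$); $|\pi|\in S_n$ is obtained by removing signs. $\pi$ contains a signed pattern $\sigma=\sigma_1\cdots\sigma_m$ if there are positions $i_1<\cdots<i_m$ such that $|\pi_{i_1}|,\ldots,|\pi_{i_m}|$ are in the same relative order as $|\sigma_1|,\ldots,|\sigma_m|$ and $\pi_{i_j}$ is signed if and only if $\sigma_j$ is signed; otherwise it avoids $\sigma$. $B_n(\sigma,\tau,\ldots)$ is the set of elements of $B_n$ avoiding all the listed patterns; $\overline{312}$ is the pattern with all three entries signed. Order on $\mathcal{GD}_n$. $\mathcal{GD}_n$ is the set of Grand-Dyck paths, i.e. lattice paths from $(0,0)$ to $(2n,0)$ with steps $U=(1,1)$, $D=(1,-1)$; $P(k)$ is the ordinate of $P$ at abscissa $k$, and $P\le Q$ iff $P(k)\le Q(k)$ for all $k$. Transport to partitions. Write a set partition of $\{1,\ldots,n\}$ in standard form: elements in each block in decreasing order, blocks in increasing order of their maxima. Its components are the parts of the finest splitting of this list of blocks into intervals of consecutive blocks such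 that the union of the blocks of each part is an interval of integers. $\widetilde{NC}(n)$ is the set of noncrossing partitions of $\{1,\ldots,n\}$ in which each component is coloured or noncoloured. Given $P\in\mathcal{GD}_n$, reflect in the $x$-axis the parts of $P$ below the $x$-axis, obtaining a Dyck path; its factors (minimal subpaths that are Dyck paths between consecutive visits to the $x$-axis) are declared coloured if they were obtained by reflection and noncoloured otherwise. Number the up steps of this Dyck path $1,\ldots,n$ from left to right and match up and down steps without crossings (as in parenthesis matching). For each maximal run of consecutive down steps, form a block consisting of the numbers of the up steps matched with the down steps of the run, coloured iff the run lies in a coloured factor. This gives a bijection $\mathcal{GD}_n\to\widetilde{NC}(n)$. Transport to permutations. The bar-removing bijection $\widetilde{NC}(n)\to B_n(312,\overline{312},2\overline{1},\overline{2}1)$ writes a partition in standard form, deletes the bars between blocks, and takes the entries in coloured components to be signed. The partial order on $B_n(312,\overline{312},2\overline{1},\overline{2}1)$ is the one transported from $\mathcal{GD}_n$ along the composition of these two bijections. The target. $S_{\pm n}$ is the set of permutations of $\{\overline{n},\ldots,\overline{1},1,\ldots,n\}$, linearly ordered as indicated. For $\pi\in B_n$, $\hat{\pi}\in S_{\pm n}$ is defined by $\hat{\pi}(i)=\overline{\pi(n+1-i)}$ and $\hat{\pi}(\overline{i})=\overline{\hat{\pi}(i)}$ for $i\in\{1,\ldots,n\}$ (so $\pi$ is the first half of the one-line notation of $\hat\pi$). $\hat{S}_{\pm n}[312,\overline{312},2\overline{1},\overline{2}1]=\{\hat{\pi}\mid\pi\in B_n(312,\overline{312},2\overline{1},\overline{2}1)\}$.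 *)

(* Defs.v *)
From mathcomp Require Import all_boot all_order all_fingroup all_algebra.

Set Implicit Arguments.
Unset Strict Implicit.
Unset Printing Implicit Defensive.

Import Order.TTheory GRing.Theory Num.Theory.

(* The numbers 1, ..., n are represented by 'I_n, where i : 'I_n stands for
   i + 1. *)

(* The set {-n, ..., -1, 1, ..., n}: (b, i) is the letter of absolute value
   i + 1, which is signed (overlined) iff b is true. *)
Definition pm (n : nat) : finType := (bool * 'I_n)%type.

Definition pm_val n (x : pm n) : int :=
  if x.1 then (- Posz x.2.+1)%R else Posz x.2.+1.

Definition pm_lt n (x y : pm n) : bool := (pm_val x < pm_val y)%R.

Definition pm_bar n (x : pm n) : pm n := (~~ x.1, x.2).

(* The first component is |pi|, the second one says which positions carry a
   signed entry. *)
Definition signed_perm (n : nat) : finType :=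
  ('S_n * {ffun 'I_n -> bool})%type.

Definition entry n (p : signed_perm n) (i : 'I_n) : pm n := (p.2 i, p.1 i).

(* Patterns are given by their words over the nonzero integers. *)
Definition contains n (sigma : seq int) (p : signed_perm n) : bool :=
  [exists f : {ffun 'I_(size sigma) -> 'I_n},
    [forall a, forall b,
      [&& (f a < f b) == (a < b),
          ((entry p (f a)).2 < (entry p (f b)).2)
            == (absz (nth 0%R sigma a) < absz (nth 0%R sigma b))
        & (entry p (f a)).1 == (nth 0%R sigma a < 0)%R]]].

Definition avoiding_set n (patterns : seq (seq int)) : {set signed_perm n} :=
  [set p | all (fun sigma => ~~ contains sigma p) patterns].

Definition patterns312 : seq (seq int) :=
  [:: [:: 3; 1; 2]; [:: -3; -1; -2]; [:: 2; -1]; [:: -2; 1]]%Z.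

(* A path is the word of its steps; true is U and false is D. *)
Definition height (s : seq bool) (k : nat) : int :=
  (\sum_(b <- take k s) (if b then 1 else -1))%R.

Definition grand_dyck n (P : n.*2.-tuple bool) : Prop := height P n.*2 = 0%R.

Definition path_le n (P Q : n.*2.-tuple bool) : Prop :=
  forall k, k <= n.*2 -> (height P k <= height Q k)%R.

Definition is_dyck (s : seq bool) : bool :=
  (height s (size s) == 0%R)
  && [forall k : 'I_(size s).+1, (0 <= height s k)%R].

(* The step number j goes from abscissa j to abscissa j + 1. *)
Definition below (s : seq bool) (j : nat) : bool :=
  (height s j < 0)%R || (height s j.+1 < 0)%R.

Definition reflect_path n (P : n.*2.-tuple bool) : n.*2.-tuple bool :=
  [tuple tnth P j (+) below P j | j < n.*2].

(* Parenthesis matching: an up step i is matched with a down step j when the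
   steps strictly between them form a Dyck path. *)
Definition matched (s : seq bool) (i j : nat) : bool :=
  [&& i < j, nth false s i, ~~ nth true s j & is_dyck (drop i.+1 (take j s))].

(* 0-based number of the up step at position i, among the up steps. *)
Definition up_number (s : seq bool) (i : nat) : nat := count id (take i s).

Definition same_run m (s : m.-tuple bool) (j k : 'I_m) : bool :=
  [forall l : 'I_m, (minn j k <= l <= maxn j k) ==> ~~ tnth s l].

Definition run_block n (s : n.*2.-tuple bool) (j : 'I_(n.*2)) : {set 'I_n} :=
  [set u : 'I_n | [exists i : 'I_(n.*2), exists k : 'I_(n.*2),
             [&& same_run s j k, matched s i k & up_number s i == u]]].

Section Partitions.

Variable n : nat.
Implicit Types (A B : {set 'I_n}) (P : {set {set 'I_n}}).

(* The pair (set of blocks, set of blocks lying in a coloured component). *)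
Definition coloured_partition : Type := {set {set 'I_n}} * {set {set 'I_n}}.

Definition block_max A : nat := \max_(x in A) x.

Definition standard_form P : seq {set 'I_n} :=
  sort (fun A B => block_max A <= block_max B) (enum P).

Definition noncrossing P : Prop :=
  forall A B (a b c d : 'I_n), A \in P -> B \in P ->
    a < b -> b < c -> c < d ->
    a \in A -> c \in A -> b \in B -> d \in B -> A = B.

Definition is_interval A : Prop :=
  forall x y z : 'I_n, x \in A -> z \in A -> x <= y <= z -> y \in A.

Definition interval_splitting P (ss : seq (seq {set 'I_n})) : Prop :=
  flatten ss = standard_form P /\
  forall S, S \in ss -> S <> [::] /\ is_interval (\bigcup_(A <- S) A).

(* ss is the finest splitting: every other one is obtained by concatenating
   consecutive parts of ss. *)
Definition components P (ss : seq (seq {set 'I_n})) : Prop :=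
  interval_splitting P ss /\
  forall tt, interval_splitting P tt ->
    exists uu : seq (seq (seq {set 'I_n})),
      flatten uu = ss /\ map flatten uu = tt.

Definition coloured_nc (X : coloured_partition) : Prop :=
  [/\ partition X.1 [set: 'I_n], noncrossing X.1, X.2 \subset X.1
    & forall ss S, components X.1 ss -> S \in ss ->
        {subset S <= X.2} \/ (forall A, A \in S -> A \notin X.2)].

(* The word obtained by deleting the bars between the blocks. *)
Definition standard_word P : seq 'I_n :=
  flatten [seq rev (enum A) | A : {set 'I_n} <- standard_form P].

(* The entries of p, read from left to right, are the letters of the standard
   form of X, signed iff they lie in a coloured component. *)
Definition bar_removal (X : coloured_partition) (p : signed_perm n) : Prop :=
  [seq entry p i | i <- enum 'I_n]
  = [seq (x \in cover X.2, x) | x <- standard_word X.1].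

(* A step of the reflected path lies in a coloured factor iff it was obtained
   by reflection. *)
Definition path_partition (P : n.*2.-tuple bool) : coloured_partition :=
  let s := reflect_path P in
  ([set run_block s j | j : 'I_(n.*2) & ~~ tnth s j],
   [set run_block s j | j : 'I_(n.*2) & ~~ tnth s j && below P j]).

End Partitions.

(* The order le on the carrier C, transported along the graph F of a
   bijection. *)
Definition transported (T U : Type) (C : T -> Prop) (F : T -> U -> Prop)
    (le : T -> T -> Prop) (u v : U) : Prop :=
  exists x y : T, [/\ C x, C y, F x u, F y v & le x y].

Definition coloured_nc_le n : coloured_partition n -> coloured_partition n -> Prop :=
  transported (@grand_dyck n) (fun P X => path_partition P = X) (@path_le n).

Definition signed_perm_le n : signed_perm n -> signed_perm n -> Prop :=
  transported (@coloured_nc n) (@bar_removal n) (@coloured_nc_le n).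

(* hat p (i) = bar (p (n + 1 - i)) and hat p (bar i) = bar (hat p (i)). *)
Definition hat_fun n (p : signed_perm n) (x : pm n) : pm n :=
  if x.1 then entry p (rev_ord x.2) else pm_bar (entry p (rev_ord x.2)).

Lemma hat_fun_inj n (p : signed_perm n) : injective (hat_fun p).
Proof.
move=> [b i] [c j]; rewrite /hat_fun /pm_bar /entry /=.
case: b; case: c => -[] eq_sign /perm_inj /rev_ord_inj eq_ij; subst j => //.
- by case: (p.2 _) eq_sign.
- by case: (p.2 _) eq_sign.
Qed.

Definition hat n (p : signed_perm n) : {perm pm n} := perm (@hat_fun_inj n p).

Definition inversions n (s : {perm pm n}) : nat :=
  #|[set xy : pm n * pm n | pm_lt xy.1 xy.2 && pm_lt (s xy.2) (s xy.1)]|.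

(* tperm x y * s is s with the entries in the positions x and y exchanged. *)
Definition bruhat_step n : rel {perm pm n} := fun s t =>
  [exists x : pm n, exists y : pm n,
    [&& x != y, t == (tperm x y * s)%g & inversions s < inversions t]].

Definition bruhat_le n : rel {perm pm n} := connect (@bruhat_step n).

Definition poset_isomorphic (T U : finType)
    (A : {set T}) (leA : T -> T -> Prop)
    (B : {set U}) (leB : U -> U -> Prop) : Prop :=
  exists f : T -> U,
    [/\ {in A &, injective f}, f @: A = B
      & {in A &, forall x y, leA x y <-> leB (f x) (f y)}].

(* Main.v *)
Require Import Defs.
From mathcomp Require Import all_boot all_order all_fingroup all_algebra.
From mathcomp Require Import zify.

Set Implicit Arguments.
Unset Strict Implicit.
Unset Printing Implicit Defensive.

Import Order.TTheory GRing.Theory Num.Theory.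

(** The isomorphism is [hat] itself, and both orders are compared with the order
    on height functions.  Positions and absolute values are numbered from 0.

    Let [P] be a Grand-Dyck path and reflect its negative parts.  Reading the
    reflected path as a program for a stack that receives 0, 1, 2, ..., where an
    up step pushes and a down step pops, the successive outputs form the word
    obtained from the blocks of the partition of [P] in standard form.  Hence the
    signed permutation [p] of [P] has two properties, which define [stackable]:
    [|p|] is the output of a stack, and the signs of [p] are constant between
    consecutive visits of the path to the axis.  Avoidance of the four patterns
    implies both ([avoiding_stackable]).

    Conversely [p] determines the path.  In the reflected path, the number of up
    steps before the [k]-th down step is [pmax p k], one more than the largest of
    the [|p_i|] with [i <= k]; so the height function is an explicit expression
    [walk p] in the prefix maxima and the signs.  It is the height function of a
    path ([walk_unit_path]), [p] can be recovered from it ([walk_inj]), every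
    path arises ([exists_stackable]), and the partition of the path gives [p]
    back ([path_partitionE], [stackable_path_partition]).  It remains to prove

      [hat p <= hat q] in Bruhat order iff [walk p k <= walk q k] for all [k].

    From left to right ([bruhat_walk_homo]): a Bruhat step exchanges two entries
    and puts the larger one first, so in each prefix the largest entry can only
    increase, and so can the smallest one.  The prefixes of [p] are prefixes of
    [hat p], and for [2 b < k] the inequality [walk p k >= k - 2 b] means that
    one of the first [b + 1] entries of [p] has a value [pm_val] of at least
    [k - b]; negative heights are described similarly ([leq_signed_walk]).

    From right to left ([walk_le_bruhat]): if [P <= Q] are different, then the
    lowest point of [P] that lies strictly below [Q] is a valley, and turning it
    into a peak gives a path that still lies below [Q].  The effect of this move
    on signed permutations is easily described ([bruhat_fill_valley]).  At height
    -1 it removes one sign; elsewhere it exchanges two entries of equal sign.  In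
    both cases [hat p] is multiplied by one or two transpositions, each of which
    increases the number of inversions. *)

(** * Bruhat order on the signed letters *)

Lemma pm_val_inj n : injective (@pm_val n).
Proof.
move=> [b i] [c j]; rewrite /pm_val /=.
by case: b; case: c => h; congr (_, _); try apply: val_inj => /=; lia.
Qed.

(** An inversion [(u, v)] of [s] is sent to its image under the transposition of
    [x] and [y] when this image is still an increasing pair, and to itself
    otherwise.  This is an injection into the inversions of the new permutation,
    and it misses the inversion [(x, y)]. *)
Lemma inversions_tperm n (s : {perm pm n}) (x y : pm n) :
  pm_lt x y -> pm_lt (s x) (s y) ->
  inversions s < inversions (tperm x y * s)%g.
Proof.
rewrite /pm_lt => lt_xy lt_sxy; set t := (tperm x y * s)%g.
pose tau := tperm x y.
pose I (r : {perm pm n}) :=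
  [set w : pm n * pm n | pm_lt w.1 w.2 && pm_lt (r w.2) (r w.1)].
pose psi (w : pm n * pm n) :=
  if pm_lt (tau w.1) (tau w.2) then (tau w.1, tau w.2) else w.
have tE z : t z = s (tau z) by rewrite permM.
have psi_inj : {in I s &, injective psi}.
  move=> [u v] [u' v']; rewrite !inE /psi /= => /andP[lt_uv _] /andP[lt_uv' _].
  case: ifP => h1; case: ifP => h2 // -[e1 e2].
  - by congr (_, _); apply: (@perm_inj _ tau).
  - by move: h2; rewrite -e1 -e2 /tau !tpermK lt_uv.
  - by subst u v; move: h1; rewrite /tau !tpermK lt_uv'.
rewrite /inversions -/(I s) -/(I t) -(card_in_imset psi_inj); apply: proper_card.
apply/properP; split.
  apply/subsetP => _ /imsetP[[u v] uvI ->]; move: uvI.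
  rewrite !inE /psi /= => /andP[lt_uv lt_suv].
  case: ifP => /= [-> | /negbT]; first by rewrite !tE !tpermK.
  rewrite lt_uv !tE /= /tau; move: lt_uv lt_suv; rewrite /pm_lt.
  by case: (tpermP x y u) => [->|->|_ _]; case: (tpermP x y v) => [->|->|_ _]; lia.
exists (x, y); first by rewrite !inE /= !tE /tau tpermL tpermR /pm_lt lt_xy lt_sxy.
apply/negP => /imsetP[[u v]]; rewrite inE /psi /= => /andP[lt_uv lt_suv].
case: ifP => [h [ex ey] | h [ex ey]].
  move: lt_uv; rewrite -(tpermK x y u) -(tpermK x y v) -/tau -ex -ey.
  by rewrite /tau tpermL tpermR /pm_lt; lia.
by move: lt_suv; rewrite -ex -ey /pm_lt; lia.
Qed.

Lemma bruhat_tperm n (s : {perm pm n}) (x y : pm n) :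
  pm_lt x y -> pm_lt (s x) (s y) -> bruhat_le s (tperm x y * s)%g.
Proof.
move=> lt_xy lt_sxy; apply: connect1; apply/existsP; exists x.
apply/existsP; exists y; rewrite eqxx inversions_tperm // !andbT.
by apply/eqP => eq_xy; move: lt_xy; rewrite eq_xy /pm_lt; lia.
Qed.

(** The increase of the number of inversions decides which of the two exchanged
    positions carries the larger entry. *)
Lemma bruhat_stepP n (s t : {perm pm n}) : bruhat_step s t ->
  exists x y, [/\ pm_lt x y, pm_lt (s x) (s y) & t = (tperm x y * s)%g].
Proof.
case/existsP => x /existsP[y /and3P[neq_xy /eqP-> lt_inv]].
wlog lt_xy : x y neq_xy lt_inv / pm_lt x y.
  move=> W.
  case: (ltrgtP (pm_val x) (pm_val y)) => [lt_xy | lt_yx | /pm_val_inj eq_xy].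
  - exact: W.
  - by rewrite tpermC; apply: W; rewrite // 1?eq_sym // tpermC.
  - by rewrite eq_xy eqxx in neq_xy.
exists x, y; split => //; rewrite /pm_lt.
case: (ltrgtP (pm_val (s x)) (pm_val (s y))) => //
  [lt_syx | /pm_val_inj/perm_inj eq_xy].
  have := @inversions_tperm _ (tperm x y * s)%g x y lt_xy.
  rewrite !permM tpermL tpermR mulgA tperm2 mul1g => /(_ lt_syx); lia.
by rewrite eq_xy eqxx in neq_xy.
Qed.

(** A Bruhat step moves the larger of two entries to the left, so the maximum and
    the minimum over each initial segment can only increase.  This is the part of
    the tableau criterion for Bruhat order that the heights of a path can see. *)
Lemma bruhat_prefix n (s t : {perm pm n}) (z : pm n) (c : int) :
  bruhat_le s t ->
  ((exists x, (pm_val x <= pm_val z)%R /\ (c <= pm_val (s x))%R) ->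
   (exists x, (pm_val x <= pm_val z)%R /\ (c <= pm_val (t x))%R)) /\
  ((exists x, (pm_val x <= pm_val z)%R /\ (pm_val (t x) <= c)%R) ->
   (exists x, (pm_val x <= pm_val z)%R /\ (pm_val (s x) <= c)%R)).
Proof.
case/connectP => r; elim: r s => [|s' r IHr] s /=; first by move=> _ ->.
case/andP => /bruhat_stepP[x [y []]]; rewrite /pm_lt => lt_xy lt_sxy def_s'.
move=> path_r last_t; have [IH1 IH2] := IHr _ path_r last_t.
(* position x holds an extreme value at least as good as the one at y, in s for
   small entries and in t for large ones *)
pose w u := if u == y then x else u.
have neq_xy : x == y = false by apply/eqP => eq_xy; rewrite eq_xy in lt_xy; lia.
split=> [[u [le_uz le_cu]] | /IH2[u [le_uz]]].
  apply: IH1; exists (w u); rewrite /w def_s' permM.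
  case: eqP le_uz le_cu => [-> | /eqP neq_uy]; first by rewrite tpermL; lia.
  by case: tpermP neq_uy => [->|->|_ _]; rewrite ?eqxx //; lia.
rewrite def_s' permM => le_uc; exists (w u); rewrite /w.
case: eqP le_uz le_uc => [-> | /eqP neq_uy]; first by rewrite tpermR; lia.
by case: (tpermP x y u) neq_uy => [->|->|_ _]; rewrite ?eqxx //; lia.
Qed.

(** * Prefix maxima and stackable signed permutations *)

Lemma card_ord_range n a b : b <= n -> #|[set i : 'I_n | a <= i < b]| = b - a.
Proof.
move=> le_bn; rewrite -sum1_card (eq_bigl (fun i : 'I_n => a <= i < b)); last first.
  by move=> i; rewrite inE.
rewrite -(big_mkord (fun i => a <= i < b) (fun=> 1)).
rewrite -[b - a]muln1 -sum_nat_const_nat.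
rewrite (big_nat_widen a b n) // (big_nat_widenl a 0) //.
by apply: eq_bigl => i; rewrite andbC.
Qed.

Section PrefixMaxima.

Variable n : nat.
Implicit Types (p q : signed_perm n) (i j : 'I_n).

Definition mag p i : nat := p.1 i.

Lemma mag_inj p : injective (mag p).
Proof. by move=> i j /val_inj/perm_inj. Qed.

Lemma ltn_mag p i : mag p i < n.
Proof. exact: ltn_ord. Qed.

Lemma mag_onto p v : v < n -> exists i, mag p i = v.
Proof. by move=> lt_vn; exists (p.1^-1%g (Ordinal lt_vn)); rewrite /mag permKV. Qed.

(** Positions are natural numbers here, in order that the position after [k] be
    just [k.+1].  The default value beyond the last position is met only at the end
    of a path, where the height is 0. *)
Definition sg p (b : nat) : bool := [exists i : 'I_n, (i == b :> nat) && p.2 i].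

Lemma sgE p i : sg p i = p.2 i.
Proof.
apply/existsP/idP => [[j /andP[/eqP/val_inj-> //]] | p2].
by exists i; rewrite eqxx.
Qed.

Lemma sg_out p b : n <= b -> sg p b = false.
Proof. by move=> le_nb; apply/existsP => -[i /andP[/eqP]]; have := ltn_ord i; lia. Qed.

(** In the stack reading of [p], this is the number of values that have been
    pushed when the [k]-th one (counted from 0) is popped. *)
Definition pmax p (k : nat) : nat := \max_(i < n | i <= k) (mag p i).+1.

Lemma pmax_leP p k v :
  reflect (forall i, i <= k -> mag p i < v) (pmax p k <= v).
Proof. exact: bigmax_leqP. Qed.

Lemma ltn_pmax p i k : i <= k -> mag p i < pmax p k.
Proof. by move: i; apply/pmax_leP. Qed.

Lemma pmax_attained p i : exists2 i' : 'I_n, i' <= i & pmax p i = (mag p i').+1.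
Proof.
have [|i' le_i' max_i'] := @eq_bigmax_cond 'I_n [pred k : 'I_n | k <= i]
    (fun k : 'I_n => (mag p k).+1).
  by apply/card_gt0P; exists i; rewrite inE.
by exists i'.
Qed.

Lemma pmax_homo p k l : k <= l -> pmax p k <= pmax p l.
Proof. by move=> le_kl; apply/pmax_leP => i le_ik; apply: ltn_pmax; lia. Qed.

Lemma pmax_le_n p k : pmax p k <= n.
Proof. by apply/pmax_leP => i _; apply: ltn_ord. Qed.

Lemma leq_card_perm (s : 'S_n) (A B : {set 'I_n}) :
  (forall i, i \in A -> s i \in B) -> #|A| <= #|B|.
Proof.
move=> AB; rewrite -(card_imset A (@perm_inj _ s)); apply: subset_leq_card.
by apply/subsetP => _ /imsetP[i iA ->]; apply: AB.
Qed.

(** The [i + 1] first values are distinct and smaller than [pmax p i]. *)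
Lemma ltn_pmax_pos p i : i < pmax p i.
Proof.
have := @leq_card_perm p.1 [set k : 'I_n | 0 <= k < i.+1]
  [set v : 'I_n | 0 <= v < pmax p i].
rewrite !card_ord_range ?pmax_le_n // !subn0; apply => k; rewrite !inE /= => ?.
exact: ltn_pmax.
Qed.

(** The value [mag p j], too, lies below the prefix maximum, although it does not
    occur in the prefix. *)
Lemma pmax_gap p i j k :
  i <= k -> k < j -> mag p j < mag p i -> k.+1 < pmax p k.
Proof.
move=> le_ik lt_kj lt_pji.
have := @leq_card_perm p.1 (j |: [set l : 'I_n | 0 <= l < k.+1])
  [set v : 'I_n | 0 <= v < pmax p k].
rewrite cardsU1 !card_ord_range ?pmax_le_n // ?inE; last by have := ltn_ord j; lia.
have -> : (0 <= j < k.+1) = false by lia.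
rewrite !subn0 add1n; apply => l; rewrite !inE /=.
case/orP=> [/eqP-> | le_lk]; last exact: ltn_pmax.
by apply: ltn_trans lt_pji _; apply: ltn_pmax.
Qed.

(** When the [i + 1] first values fill the interval [0, i] the path is back on the
    axis, and all later values are larger. *)
Lemma pmax_axis p i j : pmax p i = i.+1 -> (mag p j <= i) = (j <= i).
Proof.
move=> max_i; apply/idP/idP => [le_pji | le_ji]; last first.
  by rewrite -ltnS -max_i; apply: ltn_pmax.
rewrite leqNgt; apply/negP => lt_ij.
have := @leq_card_perm p.1 (j |: [set l : 'I_n | 0 <= l < i.+1])
  [set v : 'I_n | 0 <= v < i.+1].
rewrite cardsU1 !card_ord_range ?inE //.
have -> : (0 <= j < i.+1) = false by lia.
move=> /= H.
suff: 1 + (i.+1 - 0) <= i.+1 - 0 by lia.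
apply: H => l; rewrite !inE /= => /orP[/eqP-> // | le_li].
by rewrite -max_i; apply: ltn_pmax.
Qed.

(** The [j]-th down step of the reflected path comes after [pmax p j] up steps and
    [j] down steps, so this counts the down steps among its [k] first steps. *)
Definition downs p (k : nat) : nat := #|[set j : 'I_n | pmax p j + j < k]|.

(** The positions of the down steps increase, so those that come before [k] are an
    initial segment. *)
Lemma ltn_downs p j k : (j < downs p k) = (pmax p j + j < k).
Proof.
apply/idP/idP => [|lt_jk].
  rewrite !ltnNge; apply: contra => le_kj.
  apply: (@leq_trans #|[set i : 'I_n | 0 <= i < j]|); last first.
    by rewrite card_ord_range ?subn0 // ltnW.
  apply: subset_leq_card; apply/subsetP => i; rewrite !inE /= => lt_i.
  by rewrite ltnNge; apply/negP => le_ji; have := pmax_homo p le_ji; lia.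
have -> : j.+1 = #|[set i : 'I_n | 0 <= i < j.+1]| by rewrite card_ord_range ?subn0.
apply: subset_leq_card; apply/subsetP => i; rewrite !inE /= => le_ij.
have : pmax p i <= pmax p j by apply: pmax_homo; lia.
by lia.
Qed.

Lemma downs_le_n p k : downs p k <= n.
Proof. by rewrite -[n in _ <= n]card_ord max_card. Qed.

Lemma downs_homo p k l : k <= l -> downs p k <= downs p l.
Proof.
by move=> le_kl; apply: subset_leq_card; apply/subsetP => i; rewrite !inE; lia.
Qed.

Lemma downs_uniq p b k : b <= n ->
  (forall j, (j < b) = (pmax p j + j < k)) -> downs p k = b.
Proof.
move=> le_bn bE; have le_n := downs_le_n p k.
case: (ltngtP (downs p k) b) => // lt_b.
  have lt_n : downs p k < n by lia.
  by have := bE (Ordinal lt_n); have := ltn_downs p (Ordinal lt_n) k; rewrite /=; lia.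
have lt_n : b < n by lia.
by have := bE (Ordinal lt_n); have := ltn_downs p (Ordinal lt_n) k; rewrite /=; lia.
Qed.

(** The first clause says that each output is the largest value that is still on
    the stack: the later values that have already been pushed are smaller.  In the
    second clause, [k.+1 < pmax p k] means that the path is not on the axis after
    the [k]-th down step, so that the next down step lies in the same factor. *)
Definition stackable p : Prop :=
  (forall i j, i < j -> mag p j < pmax p i -> mag p j < mag p i) /\
  (forall k, k.+1 < pmax p k -> sg p k = sg p k.+1).

Lemma sg_constant_off_axis p i j : stackable p -> i <= j ->
  (forall k, i <= k -> k < j -> k.+1 < pmax p k) -> sg p i = sg p j.
Proof.
case=> _ S; move: {2}(j - i) (erefl (j - i)) => d.
elim: d (nat_of_ord j) => [|d IHd] k def_d le_ik gap; first by congr (sg p _); lia.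
rewrite (IHd k.-1); try lia; last by move=> l *; apply: gap; lia.
by rewrite (S k.-1); [congr (sg p _); lia | apply: (gap k.-1); lia].
Qed.

(** Between the positions of an inversion the path does not return to the axis. *)
Lemma sg_inversion p i j : stackable p -> i < j -> mag p j < mag p i -> sg p i = sg p j.
Proof.
move=> stack_p lt_ij lt_p; apply: sg_constant_off_axis => //; first lia.
move=> k le_ik lt_kj; have lt_n : k < n by have := ltn_ord j; lia.
exact: (@pmax_gap p i j (Ordinal lt_n)).
Qed.

(** The height of the reflected path after [k] steps is [k] minus twice the number
    of down steps.  Off the axis, the factor that contains the point is the factor
    of the next down step, hence the choice of the sign. *)
Definition walk p (k : nat) : int :=
  if sg p (downs p k) then (Posz (downs p k).*2 - Posz k)%R
  else (Posz k - Posz (downs p k).*2)%R.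

End PrefixMaxima.

(** * The path of a stackable signed permutation *)

Section Walk.

Variable n : nat.
Implicit Types (p q : signed_perm n) (i j : 'I_n).

(** Height functions of Grand-Dyck paths.  They are easier to modify at one point
    than the words of the steps. *)
Definition unit_path (h : nat -> int) : Prop :=
  [/\ h 0 = 0%R, h n.*2 = 0%R
    & forall k, k < n.*2 -> h k.+1 = (h k + 1)%R \/ h k.+1 = (h k - 1)%R].

(** The reflected path stays above the axis. *)
Lemma downs_half p k : (downs p k).*2 <= k.
Proof.
case def_b: (downs p k) => [//|b].
have lt_bn : b < n by have := downs_le_n p k; lia.
have := ltn_downs p (Ordinal lt_bn) k; have := ltn_pmax_pos p (Ordinal lt_bn).
by rewrite /=; lia.
Qed.

Lemma downs0 p : downs p 0 = 0.
Proof. by have := downs_half p 0; lia. Qed.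

Lemma downs_double p : downs p n.*2 = n.
Proof.
apply: downs_uniq => // j; have := ltn_ord j; have := pmax_le_n p j; lia.
Qed.

Lemma absz_walk p k : absz (walk p k) = k - (downs p k).*2.
Proof. by have := downs_half p k; rewrite /walk; case: ifP; lia. Qed.

Lemma downsS p k : downs p k.+1 = downs p k \/
  exists j, [/\ downs p k = j, pmax p j + j = k & downs p k.+1 = j.+1].
Proof.
case: (ltngtP (downs p k) (downs p k.+1)) => [lt_b | | ->]; last by left.
  have lt_n : downs p k < n by have := downs_le_n p k.+1; lia.
  have := ltn_downs p (Ordinal lt_n) k; have := ltn_downs p (Ordinal lt_n) k.+1.
  rewrite /= => b1 b0; right; exists (Ordinal lt_n); split => //=; first lia.
  apply/eqP; rewrite eqn_leq lt_b andbT leqNgt; apply/negP => lt2.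
  have lt_n' : (downs p k).+1 < n by have := downs_le_n p k.+1; lia.
  have := ltn_downs p (Ordinal lt_n') k.+1.
  have : pmax p (downs p k) <= pmax p (downs p k).+1 by apply: pmax_homo.
  by rewrite /=; lia.
by have := downs_homo p (leqnSn k); lia.
Qed.

(** The absolute value changes by one at each step.  The sign may change only at a
    down step that ends on the axis, by the second clause of [stackable]. *)
Lemma walk_unit_path p : stackable p -> unit_path (walk p).
Proof.
move=> stack_p; split; first by rewrite /walk downs0 if_same.
  by rewrite /walk downs_double sg_out //; lia.
move=> k lt_k; have half := downs_half p k; have half' := downs_half p k.+1.
have [eq_b | [j [def_j max_j eq_b]]] := downsS p k.
  by rewrite /walk eq_b; case: ifP => _; lia.
rewrite /walk eq_b def_j in half half' *.
have [axis|gap] : pmax p j = j.+1 \/ j.+1 < pmax p j.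
    by have := ltn_pmax_pos p j; lia.
  by case: ifP => _; case: ifP => _; lia.
by rewrite -(stack_p.2 j gap); case: ifP => _; lia.
Qed.

Definition signed_walk p (c : bool) k : int := if c then (- walk p k)%R else walk p k.

(** The dictionary between heights and prefixes.  The left side says that the
    colour of the point [k] is [c] and that at least [k - b] up steps come before
    the [b]-th down step, that is [k - b <= pmax p b].  The point of the proof is
    that the entry which attains the maximum also has the sign [c]: since
    [b.*2 < k], the path is not on the axis between the two positions, whatever
    their order. *)
Lemma leq_signed_walk p c (b : 'I_n) k : stackable p -> b.*2 < k ->
  (Posz k - Posz b.*2 <= signed_walk p c k)%R <->
  (exists i, [/\ i <= b, sg p i = c & k <= b + (mag p i).+1]).
Proof.
move=> stack_p lt_bk; have half := downs_half p k.
have lt_bn := ltn_ord b.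
split=> [le_H | [i [le_ib p2i le_k]]].
  have [le_bb sg_c] : downs p k <= b /\ sg p (downs p k) = c.
    by move: le_H; rewrite /signed_walk /walk; case: c; case: ifP; lia.
  have lt_n : downs p k < n by lia.
  pose c0 := Ordinal lt_n; have c0E : nat_of_ord c0 = downs p k by [].
  have [i le_i max_i] := pmax_attained p c0.
  have := ltn_downs p c0 k; rewrite /= max_i ltnn => /esym/negbT; rewrite -leqNgt => bk.
  exists i; split; [lia | | lia].
  rewrite -sg_c -c0E.
  case: (ltngtP i c0) => [lt_i | | /val_inj-> //]; last lia.
  apply: sg_inversion => //.
  have := ltn_pmax p (leqnn c0); rewrite max_i ltnS leq_eqVlt => /orP[] //.
  by move=> /eqP/mag_inj e; move: lt_i; rewrite e ltnn.
have max_b : k <= b + pmax p b by have := @ltn_pmax _ p i b le_ib; lia.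
have le_bb : downs p k <= b.
  by rewrite leqNgt; have := ltn_downs p b k; lia.
have lt_n : downs p k < n by lia.
pose c0 := Ordinal lt_n; have c0E : nat_of_ord c0 = downs p k by [].
(* c0 is the next down step, which decides the colour of the point k, and i is the
   position of a large entry; from either of them up to b the axis is not met *)
have gap0 x : c0 <= x -> x < b -> x.+1 < pmax p x.
  move=> le_x lt_x; have := pmax_homo p le_x; have := ltn_downs p c0 k.
  by rewrite /= in le_x *; lia.
have gapi x : i <= x -> x < b -> x.+1 < pmax p x.
  by move=> le_x lt_x; have := ltn_pmax p le_x; lia.
have sg_c : sg p (downs p k) = c.
  rewrite -c0E -p2i.
  case: (leqP c0 i) => [le_c0 | /ltnW le_i].
    apply: sg_constant_off_axis => // x le_x lt_x; apply: gap0 => //; lia.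
  apply/esym; apply: sg_constant_off_axis => // x le_x lt_x.
  by apply: gapi => //; rewrite /= in lt_x; lia.
by rewrite /signed_walk /walk sg_c; case: (c); lia.
Qed.

Lemma pm_val_entry p i :
  pm_val (entry p i) = if sg p i then (- Posz (mag p i).+1)%R else Posz (mag p i).+1.
Proof. by rewrite sgE. Qed.

(** The first half of the one-line notation of [hat p] is the word of [p]. *)
Lemma exists_prefix_hat p (b : 'I_n) (P : int -> bool) :
  (exists x : pm n,
     (pm_val x <= pm_val (true, rev_ord b))%R /\ P (pm_val (hat p x))) <->
  (exists i : 'I_n, i <= b /\ P (pm_val (entry p i))).
Proof.
split=> [[[[] i]] | [i [le_i Pi]]].
- rewrite permE /hat_fun /pm_val /= => -[le_i Pi].
  by exists (rev_ord i); split => //=; have := ltn_ord i; have := ltn_ord b; lia.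
- by rewrite permE /hat_fun /pm_val /= => -[]; lia.
exists (true, rev_ord i); rewrite permE /hat_fun /= rev_ordK; split => //.
by rewrite /pm_val /=; have := ltn_ord i; have := ltn_ord b; lia.
Qed.

(** Positive heights of [walk p] are transferred to [q] with the help of large
    entries in a prefix, and negative heights of [walk q] to [p] with the help of
    small entries; when neither case applies, 0 separates the two heights. *)
Lemma bruhat_walk_homo p q : stackable p -> stackable q -> bruhat_le (hat p) (hat q) ->
  forall k, k <= n.*2 -> (walk p k <= walk q k)%R.
Proof.
move=> stack_p stack_q le_pq k le_k.
have halfp := downs_half p k; have halfq := downs_half q k.
have key c p' q' : stackable p' -> stackable q' ->
    (forall (b : 'I_n) (v : nat),
      (exists i, [/\ i <= b, sg p' i = c & v <= mag p' i]) ->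
      (exists i, [/\ i <= b, sg q' i = c & v <= mag q' i])) ->
    (0 < signed_walk p' c k)%R -> (signed_walk p' c k <= signed_walk q' c k)%R.
  move=> stack_p' stack_q' reach H_gt0; have half := downs_half p' k.
  have lt_n : downs p' k < n.
    by move: H_gt0; have := absz_walk p' k; rewrite /signed_walk; case: (c); lia.
  pose b := Ordinal lt_n; have bE : nat_of_ord b = downs p' k by [].
  have lt_bk : b.*2 < k.
    by move: H_gt0; have := absz_walk p' k; rewrite /signed_walk /=; case: (c); lia.
  have Hb : signed_walk p' c k = (Posz k - Posz b.*2)%R.
    by move: H_gt0; rewrite /signed_walk /walk /=; case: (c); case: ifP; lia.
  rewrite Hb; apply/leq_signed_walk => //.
  have /leq_signed_walk : (Posz k - Posz b.*2 <= signed_walk p' c k)%R by rewrite Hb.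
  case=> // i [le_i p2i le_ki].
  have [i' [le_i' q2i' le_ki']] :
      exists i, [/\ i <= b, sg q' i = c & k - b.+1 <= mag q' i].
    by apply: reach; exists i; split => //; lia.
  by exists i'; split => //; rewrite /= in le_ki' *; lia.
have keyF : (0 < walk p k)%R -> (walk p k <= walk q k)%R.
  apply: (key false) => // b v [i [le_i p2i le_v]].
  have [pre _] := @bruhat_prefix _ _ _ (true, rev_ord b) (Posz v.+1) le_pq.
  pose P (x : int) := (v.+1%:Z <= x)%R.
  have hi : exists i : 'I_n, i <= b /\ P (pm_val (entry p i)).
    by exists i; split => //; rewrite /P pm_val_entry p2i; lia.
  have [i' [le_i' ]] :=
    (exists_prefix_hat q b P).1 (pre ((exists_prefix_hat p b P).2 hi)).
  rewrite /P pm_val_entry.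
  case: ifP => q2i'; first lia.
  by exists i'; split => //; lia.
have keyT : (0 < - walk q k)%R -> (- walk q k <= - walk p k)%R.
  apply: (key true) => // b v [i [le_i q2i le_v]].
  have [_ pre] := @bruhat_prefix _ _ _ (true, rev_ord b) (- Posz v.+1) le_pq.
  pose P (x : int) := (x <= - v.+1%:Z)%R.
  have hi : exists i : 'I_n, i <= b /\ P (pm_val (entry q i)).
    by exists i; split => //; rewrite /P pm_val_entry q2i; lia.
  have [i' [le_i' ]] :=
    (exists_prefix_hat p b P).1 (pre ((exists_prefix_hat q b P).2 hi)).
  rewrite /P pm_val_entry.
  case: ifP => p2i'; last lia.
  by exists i'; split => //; lia.
lia.
Qed.

(** The absolute heights give the prefix maxima, and the height just before the
    [i]-th down step gives the sign of the [i]-th entry.  Finally a stackable [|p|]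
    is determined by its prefix maxima, because each entry is the largest value
    below the current maximum that has not been used. *)
Lemma walk_inj p q : stackable p -> stackable q ->
  (forall k, k <= n.*2 -> walk p k = walk q k) -> p = q.
Proof.
move=> stack_p stack_q eqH.
have eq_b k : k <= n.*2 -> downs p k = downs q k.
  move=> le_k; have := absz_walk p k; rewrite eqH // absz_walk.
  by have := downs_half p k; have := downs_half q k; lia.
have eq_max i : pmax p i = pmax q i.
  have := ltn_downs p i (pmax p i + i); have := ltn_downs p i (pmax p i + i).+1.
  have := ltn_downs q i (pmax p i + i); have := ltn_downs q i (pmax p i + i).+1.
  have lt_in := ltn_ord i; have le_n := pmax_le_n p i.
  by rewrite !eq_b; lia.
have eq_perm : p.1 = q.1.
  (* Suppose that r and r' agree before d.  A larger value of r' at d occurs in r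
     after d and was already pushed, so it is smaller than the value of r at d. *)
  have half r r' d : stackable r -> (forall i, pmax r i = pmax r' i) ->
      (forall i, i < d -> mag r i = mag r' i) -> forall i, i = d :> nat ->
      mag r' i <= mag r i.
    move=> stack_r eq_m eq_lt i def_i; rewrite leqNgt; apply/negP => lt_i.
    have [j def_j] := mag_onto r (ltn_mag r' i).
    have lt_ij : i < j.
      case: (ltngtP i j) => // [lt_ji | /val_inj eq_ij].
        move: def_j; rewrite eq_lt -?def_i // => /mag_inj eq_ji.
        by rewrite eq_ji ltnn in lt_ji.
      by move: lt_i; rewrite -def_j eq_ij ltnn.
    have := stack_r.1 i j lt_ij; rewrite def_j eq_m ltn_pmax // => /(_ isT); lia.
  suff eq_mag d : forall i, i < d -> mag p i = mag q i.
    by apply/permP => i; apply: val_inj; apply: (eq_mag i.+1).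
  elim: d => // d IHd i; rewrite ltnS leq_eqVlt => /orP[/eqP def_i | /IHd //].
  apply/eqP; rewrite eqn_leq; apply/andP; split.
    by apply: (half q p d) => // j lt_jd; rewrite IHd.
  exact: (half p q d).
have eq_sg i : sg p i = sg q i.
  have bi (r : signed_perm n) : pmax r i = pmax p i -> downs r (pmax p i + i) = i.
    move=> r_i; apply: downs_uniq => [|j]; first by have := ltn_ord i; lia.
    rewrite -r_i; case: (ltngtP j i) => [lt_ji | lt_ij | /val_inj->]; rewrite ?ltnn //.
      by have := pmax_homo r (ltnW lt_ji); lia.
    by have := pmax_homo r (ltnW lt_ij); lia.
  have := eqH (pmax p i + i); have := ltn_ord i; have := pmax_le_n p i.
  rewrite /walk !bi //; have := ltn_pmax_pos p i.
  by case: (sg p i); case: (sg q i) => //; lia.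
rewrite [p]surjective_pairing [q]surjective_pairing eq_perm; congr (_, _).
by apply/ffunP => i; rewrite -!sgE.
Qed.

End Walk.

(** * Filling valleys of paths *)

Section Valleys.

Variable n : nat.
Implicit Types (p q : signed_perm n) (i j : 'I_n).

Lemma hatE p x : hat p x = hat_fun p x.
Proof. exact: permE. Qed.

Definition swap p i j : signed_perm n := ((tperm i j * p.1)%g, p.2).

Lemma mag_swap p i j k : mag (swap p i j) k = mag p (tperm i j k).
Proof. by rewrite /mag permM. Qed.

Lemma swapK p i j : swap (swap p i j) i j = p.
Proof. by rewrite /swap mulgA tperm2 mul1g -surjective_pairing. Qed.

(** In [hat p] the exchange occurs twice, in the word of [p] and in its mirror
    image, where both the order of the positions and the signs are reversed; so
    both transpositions go in the same direction. *)
Lemma bruhat_swap p i j : i < j -> sg p i = sg p j ->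
  pm_lt (entry p i) (entry p j) -> bruhat_le (hat p) (hat (swap p i j)).
Proof.
rewrite !sgE => lt_ij eq_sg lt_e.
pose x1 : pm n := (true, rev_ord i); pose x2 : pm n := (true, rev_ord j).
pose y1 : pm n := (false, rev_ord j); pose y2 : pm n := (false, rev_ord i).
have neq_pm (b c : bool) (k l : 'I_n) : (b != c) || (k != l) -> (b, k) != (c, l).
  by move=> h; apply/eqP => -[eb ek]; rewrite eb ek !eqxx in h.
have neq_rev : rev_ord i != rev_ord j.
  by apply/eqP => /rev_ord_inj eq_ij; rewrite eq_ij ltnn in lt_ij.
have def_q : hat (swap p i j) = (tperm y1 y2 * (tperm x1 x2 * hat p))%g.
  have entry_q k : entry (swap p i j) k = entry p (tperm i j k).
    by rewrite /entry /= permM; case: tpermP => // ->; rewrite eq_sg.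
  have tperm_rev b r : tperm (b, rev_ord i) (b, rev_ord j) (b, r)
      = (b, rev_ord (tperm i j (rev_ord r))) :> pm n.
    have [->|neq_i] := eqVneq r (rev_ord i); first by rewrite tpermL rev_ordK tpermL.
    have [->|neq_j] := eqVneq r (rev_ord j); first by rewrite tpermR rev_ordK tpermR.
    have neq_ir : i != rev_ord r by apply: contraNneq neq_i => ->; rewrite rev_ordK.
    have neq_jr : j != rev_ord r by apply: contraNneq neq_j => ->; rewrite rev_ordK.
    rewrite (tpermD neq_ir neq_jr) rev_ordK tpermD // neq_pm //.
      by rewrite eq_sym neq_i orbT.
    by rewrite eq_sym neq_j orbT.
  have tperm_other b c k l r : b != c -> tperm (b, k) (b, l) (c, r) = (c, r) :> pm n.
    by move=> neq_bc; rewrite tpermD // neq_pm // neq_bc.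
  apply/permP => -[[] r]; rewrite !permM.
    by rewrite tperm_other // tperm_rev !hatE /hat_fun /= entry_q rev_ordK.
  by rewrite (tpermC y1) tperm_rev tperm_other // !hatE /hat_fun /= entry_q rev_ordK.
have lt_x : pm_lt x1 x2 by rewrite /pm_lt /pm_val /=; have := ltn_ord j; lia.
have lt_y : pm_lt y1 y2 by rewrite /pm_lt /pm_val /=; have := ltn_ord j; lia.
rewrite def_q; apply: (connect_trans (y := (tperm x1 x2 * hat p)%g));
  apply: bruhat_tperm => //.
  by rewrite !hatE /hat_fun /= !rev_ordK.
rewrite !permM !tpermD ?neq_pm // !hatE /hat_fun /= !rev_ordK.
move: lt_e; rewrite /pm_lt /pm_bar /pm_val /=.
by case: (p.2 i); case: (p.2 j) => //=; lia.
Qed.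

Definition unsign p i : signed_perm n :=
  (p.1, [ffun k => (k != i) && p.2 k]).

Lemma sg_unsign p i k : sg (unsign p i) k = (k != i) && sg p k.
Proof.
have [lt_kn|le_nk] := ltnP k n; last by rewrite !sg_out // andbF.
by rewrite -[k]/(nat_of_ord (Ordinal lt_kn)) !sgE ffunE.
Qed.

(** The two affected positions of [hat p] are opposite to each other. *)
Lemma bruhat_unsign p i : sg p i -> bruhat_le (hat p) (hat (unsign p i)).
Proof.
rewrite sgE => p2i.
pose x : pm n := (true, rev_ord i); pose y : pm n := (false, rev_ord i).
have -> : hat (unsign p i) = (tperm x y * hat p)%g.
  apply/permP => -[b r]; rewrite permM !hatE /hat_fun.
  case: tpermP => [[-> ->]|[-> ->]|] /=.
  - by rewrite rev_ordK /pm_bar /entry /= ffunE eqxx p2i.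
  - by rewrite rev_ordK /pm_bar /entry /= ffunE eqxx p2i.
  move=> neq_x neq_y; suff neq_i : rev_ord r != i.
    by rewrite /entry ffunE neq_i.
  apply/eqP => eq_i; move: neq_x neq_y; rewrite /x /y -eq_i rev_ordK.
  by case: (b).
apply: bruhat_tperm; first by rewrite /pm_lt /pm_val /=; lia.
by rewrite !hatE /hat_fun /= rev_ordK /pm_bar /entry p2i /pm_lt /pm_val /=; lia.
Qed.

(** After the [j]-th down step comes an up step, which pushes the value
    [y = pmax p j].  If the two steps are exchanged, then [y] is pushed and popped
    at once, and the value [x] that was popped before takes the place of [y] on the
    stack.  So [x] and [y] exchange their positions in the output, and only the
    [j]-th prefix maximum changes.  As [x < y], the exchange goes up in Bruhat
    order for positive entries and down for negative ones. *)
Lemma stackable_raise p j c : stackable p -> j.+1 < n -> pmax p j < pmax p j.+1 ->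
  sg p j = c -> sg p j.+1 = c ->
  exists q, [/\ stackable q, forall k, pmax q k = pmax p k + (k == j),
                forall k, sg q k = sg p k
              & if c then bruhat_le (hat q) (hat p) else bruhat_le (hat p) (hat q)].
Proof.
move=> stack_p lt_jn lt_max sg_j sg_j1.
have [l mag_l] : exists l, mag p l = pmax p j.
  by apply: mag_onto; have := pmax_le_n p j.+1; lia.
have lt_jl : j < l by rewrite ltnNge; apply/negP => /(ltn_pmax p); lia.
have lt_jmax := ltn_pmax p (leqnn j).
have sg_l : sg p l = c.
  have [eq_l|neq_l] := eqVneq (nat_of_ord l) j.+1; first by rewrite eq_l.
  have lt_l : j.+1 < l by lia.
  rewrite -sg_j1; apply/esym; apply: (@sg_inversion _ p (Ordinal lt_jn)) => //.
  by apply: stack_p.1 => //=; lia.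
pose q := swap p j l.
(* in the stack description, y is mag p l and x is mag p j *)
have magq i : mag q i = if i == j then mag p l else if i == l then mag p j else mag p i.
  rewrite mag_swap; case: tpermP => [->|->|/eqP/negPf-> /eqP/negPf->];
    by rewrite ?eqxx //; case: eqP => // ->.
have magqj : mag q j = mag p l by rewrite magq eqxx.
have sgq k : sg q k = sg p k by [].
have neq_nat i k : (i == k) = (nat_of_ord i == k) by [].
have maxq k : pmax q k = pmax p k + (k == j :> nat).
  apply/eqP; rewrite eqn_leq; apply/andP; split.
    apply/pmax_leP => i le_ik; rewrite magq !neq_nat.
    have := ltn_pmax p le_ik; case: (ltngtP k j) => [lt_kj | lt_jk | eq_k].
    - by case: (i =P j :> nat) => ?; case: (i =P l :> nat) => ?; lia.
    - have := @pmax_homo _ p j k (ltnW lt_jk); have := @pmax_homo _ p _ _ lt_jk.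
      by case: (i =P j :> nat) => ?; case: (i =P l :> nat) => ?; lia.
    - by rewrite eq_k; case: (i =P j :> nat) => ?; case: (i =P l :> nat) => ?; lia.
  case: (ltngtP k j) => [lt_kj | lt_jk | eq_k].
  - rewrite addn0; apply/pmax_leP => i le_ik; have := ltn_pmax q le_ik.
    rewrite magq !neq_nat.
    by case: (i =P j :> nat) => ?; case: (i =P l :> nat) => ?; lia.
  - rewrite addn0; apply/pmax_leP => i le_ik.
    have := ltn_pmax q (ltnW lt_jk); rewrite magqj => gt_l.
    have := ltn_pmax q le_ik; rewrite magq.
    by case: (i =P j) => [->|_]; [|case: (i =P l) => [->|_]]; lia.
  - by rewrite eq_k addn1 -mag_l -magqj; apply: ltn_pmax.
exists q; split => //; last first.
  case: c sg_j sg_j1 sg_l => sg_j sg_j1 sg_l.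
    rewrite -(swapK p j l); apply: bruhat_swap => //; first by rewrite !sgq sg_j sg_l.
    rewrite /pm_lt !pm_val_entry !sgq sg_j sg_l !magq eqxx eqxx.
    by case: (l =P j) => [e|_]; [rewrite e ltnn in lt_jl | lia].
  apply: bruhat_swap => //; first by rewrite sg_j sg_l.
  by rewrite /pm_lt !pm_val_entry sg_j sg_l; lia.
split=> [a b lt_ab | k]; last first.
  rewrite maxq !sgq; case: (k =P j :> nat) => [-> _|_]; first by rewrite sg_j sg_j1.
  by rewrite addn0; apply: stack_p.2.
have G := stack_p.1; have magI := @mag_inj _ p.
rewrite maxq !magq !neq_nat.
case: (ltngtP a j) => [lt_aj | lt_ja | /val_inj eq_a].
- have := G a b lt_ab; have := G a l (ltn_trans lt_aj lt_jl); have := G a j lt_aj.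
  rewrite addn0; case: (a =P l :> nat) => [e|_]; first lia.
  by case: (b =P j :> nat) => ?; [| case: (b =P l :> nat) => ?]; lia.
- have lt_jb : j < b by lia.
  have := G a b lt_ab; rewrite addn0.
  case: (b =P j :> nat) => [e|_]; first lia.
  case: (a =P l :> nat) => [/val_inj ea|_].
    case: (b =P l :> nat) => [e|_]; first by rewrite -ea in e; lia.
    by have := G j b lt_jb; have := @pmax_homo _ p _ _ (ltnW lt_ja); rewrite ea; lia.
  case: (b =P l :> nat) => [/val_inj eb|_] //.
  by rewrite eb; have := G a l; rewrite -{1}eb => /(_ lt_ab);
     have := @pmax_homo _ p _ _ lt_ja; lia.
- rewrite eq_a in lt_ab *.
  case: (b =P j :> nat) => [e|_]; first lia.
  case: (b =P l :> nat) => [e|neq_bl]; first lia.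
  have : mag p b <> mag p l by move/magI => e; apply: neq_bl; rewrite e.
  by lia.
Qed.

Lemma eq_walk p q k : downs q k = downs p k ->
  (forall b, sg q b = sg p b) -> walk q k = walk p k.
Proof. by rewrite /walk => -> ->. Qed.

(** The path [h] moved by [e] at the single point [k0]. *)
Definition shift (h : nat -> int) (k0 : nat) (e : int) (k : nat) : int :=
  (h k + (if k == k0 then e else 0))%R.

(** [c] selects the side of the axis: for [c = true] the valley is one of the
    opposite path, hence a peak below the axis. *)
Lemma stackable_fill_valley p c k : stackable p -> k.+2 <= n.*2 ->
  (0 <= signed_walk p c k.+1)%R ->
  signed_walk p c k = (signed_walk p c k.+1 + 1)%R ->
  signed_walk p c k.+2 = (signed_walk p c k.+1 + 1)%R ->
  exists q, [/\ stackable q,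
      forall k', signed_walk q c k' = shift (signed_walk p c) k.+1 2 k'
    & if c then bruhat_le (hat q) (hat p) else bruhat_le (hat p) (hat q)].
Proof.
move=> stack_p le_k ge0 H0 H2.
have sgE' m : (0 < signed_walk p c m)%R ->
    sg p (downs p m) = c /\ signed_walk p c m = (Posz m - Posz (downs p m).*2)%R.
  by have := downs_half p m; rewrite /signed_walk /walk; case: (c); case: ifP; lia.
have [|sg0 E0] := sgE' k; first lia.
have [|sg2 E2] := sgE' k.+2; first lia.
have E1 : signed_walk p c k.+1 = (Posz k.+1 - Posz (downs p k.+1).*2)%R.
  have := absz_walk p k.+1; have := downs_half p k.+1; move: ge0.
  by rewrite /signed_walk; case: (c); lia.
have [|[j [def_j max_j eq_b1]]] := downsS p k; first by lia.
have eq_b2 : downs p k.+2 = j.+1 by lia.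
have lt_jn : j.+1 < n by lia.
have lt_max : pmax p j < pmax p j.+1.
  by have := ltn_downs p (Ordinal lt_jn) k.+2; rewrite /= eq_b2 ltnn; lia.
rewrite def_j in sg0; rewrite eq_b2 in sg2.
have [q [stack_q maxq sgq le_q]] := stackable_raise stack_p lt_jn lt_max sg0 sg2.
have bq k' : downs q k' = downs p k' - (k' == k.+1).
  apply: downs_uniq => [|i]; first by have := downs_le_n p k'; lia.
  rewrite maxq; have := ltn_downs p i k'.
  have [->|neq_k] := eqVneq k' k.+1.
    rewrite eq_b1; case: (ltngtP i j) => [lt_ij|lt_ji|->]; rewrite /=; try lia.
  case: (i =P j :> nat) => [->|_] /=; last by rewrite subn0 addn0.
  by lia.
exists q; split => // k'; rewrite /shift.
have [eq_k|neq_k] := eqVneq k' k.+1; last first.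
  rewrite addr0 /signed_walk; suff -> : walk q k' = walk p k' by [].
  by apply: eq_walk => //; rewrite bq (negPf neq_k) subn0.
rewrite eq_k E1 eq_b1 /signed_walk /walk bq eqxx eq_b1 subn1 /= sgq sg0.
by case: (c); lia.
Qed.

Lemma unit_path_parity h k : unit_path n h -> k <= n.*2 ->
  exists d : int, h k = (Posz k - d - d)%R.
Proof.
case=> h0 _ step; elim: k => [_|k IHk lt_k]; first by exists 0%R; rewrite h0.
have [d def_d] := IHk (ltnW lt_k).
by case: (step k lt_k) => ->; rewrite def_d; [exists d | exists (d + 1)%R]; lia.
Qed.

Lemma unit_path_shift h k e : unit_path n h -> k.+1 < n.*2 ->
  h k = (h k.+1 + e)%R -> h k.+2 = (h k.+1 + e)%R ->
  unit_path n (shift h k.+1 (e + e)%R).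
Proof.
case=> h0 h2n step lt_k ek ek2; split; rewrite /shift.
- by rewrite h0.
- by rewrite h2n; case: eqP => ?; lia.
move=> l lt_l; have := step l lt_l.
case: (l =P k.+1) => [-> | ?]; first by rewrite gtn_eqF ?leqnn // ek2; lia.
by rewrite eqSS; case: (l =P k) => [-> | ?]; rewrite ?ek; lia.
Qed.

(** Here the reflected path is a sequence of [n] factors with two steps, so [|p|]
    is the identity, and the signs are arbitrary. *)
Lemma exists_stackable_zigzag h : unit_path n h ->
  (forall k, k <= n.*2 -> (-1 <= h k <= 1)%R) ->
  exists2 p : signed_perm n, stackable p & forall k, k <= n.*2 -> walk p k = h k.
Proof.
move=> path_h small.
pose p : signed_perm n := (1%g, [ffun i : 'I_n => (h i.*2.+1 < 0)%R]).
have magp i : mag p i = i by rewrite /mag /= perm1.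
have maxp i : pmax p i = i.+1.
  apply/eqP; rewrite eqn_leq ltn_pmax_pos andbT; apply/pmax_leP => i' le_i.
  by rewrite magp.
exists p => [|k le_k].
  split=> [i j lt_ij | k lt_k]; first by rewrite maxp !magp; lia.
  have [lt_kn|le_nk] := ltnP k n; last by rewrite !sg_out // ltnW.
  by have := maxp (Ordinal lt_kn); rewrite /=; lia.
have bp : downs p k = k./2.
  apply: downs_uniq => [|j]; first lia.
  by rewrite maxp; lia.
have [d def_d] := unit_path_parity path_h le_k; have := small k le_k.
rewrite /walk bp; have [lt_n|le_n] := ltnP k./2 n; last first.
  by rewrite sg_out //; lia.
rewrite -[k./2]/(nat_of_ord (Ordinal lt_n)) sgE ffunE /=.
have [odd_k|even_k] := boolP (odd k); last by case: ifP; lia.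
have -> : k./2.*2.+1 = k by lia.
by case: ifP; lia.
Qed.

(** By induction on the area between the path and the axis.  A point where the
    distance to the axis is largest, and at least 2, can be moved by 2 towards the
    axis; it becomes a valley, seen from the axis, of a path to which the induction
    hypothesis applies, and this valley is filled again. *)
Lemma exists_stackable h : unit_path n h ->
  exists2 p : signed_perm n, stackable p & forall k, k <= n.*2 -> walk p k = h k.
Proof.
move: {2}(\sum_(k < n.*2) absz (h k)) (leqnn (\sum_(k < n.*2) absz (h k))) => s.
elim: s h => [|s IHs] h le_s path_h; have [h0 h2n step] := path_h.
  apply: exists_stackable_zigzag => // k; rewrite leq_eqVlt => /orP[/eqP-> | lt_k].
    by rewrite h2n.
  by move: le_s; rewrite (bigD1 (Ordinal lt_k)) //=; lia.
pose K := [arg max_(k > ord0 : 'I_(n.*2).+1) absz (h k)].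
have maxK k : k <= n.*2 -> absz (h k) <= absz (h K).
  rewrite -ltnS /K; case: arg_maxnP => //= i _ max_i lt_k.
  exact: (max_i (Ordinal lt_k)).
have [small|large] := leqP (absz (h K)) 1.
  by apply: exists_stackable_zigzag => // k /maxK; lia.
have le_K : K <= n.*2 by rewrite -ltnS.
move: (nat_of_ord K) le_K maxK large => {}K le_K maxK large.
have lt_K : K < n.*2.
  by rewrite ltn_neqAle le_K andbT; apply/eqP => eK; rewrite eK h2n in large.
case: K lt_K {le_K} maxK large => [|k lt_k maxK large]; first by rewrite h0.
have [c [e [def_e sgn]]] : exists c : bool, exists e : int,
    e = (if c then 1 else -1)%R /\ (if c then h k.+1 < -1 else 1 < h k.+1)%R.
  exists (h k.+1 < 0)%R; exists (if (h k.+1 < 0)%R then 1 else -1)%R; split => //.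
  by case: ltrP; lia.
have ek : h k = (h k.+1 + e)%R.
  have := maxK k (ltnW (ltnW lt_k)); have := step k (ltnW lt_k).
  by move: sgn; rewrite def_e; case: (c); lia.
have ek2 : h k.+2 = (h k.+1 + e)%R.
  have := maxK k.+2 lt_k; have := step k.+1 lt_k.
  by move: sgn; rewrite def_e; case: (c); lia.
have path_h' := unit_path_shift path_h lt_k ek ek2.
have [|p' stack_p' Hp'] := IHs _ _ path_h'.
  rewrite -ltnS; apply: leq_trans le_s.
  rewrite (bigD1 (Ordinal lt_k)) // [X in _ < X](bigD1 (Ordinal lt_k)) //=.
  rewrite -addSn leq_add //.
    by move: sgn; rewrite /shift eqxx def_e; case: (c); lia.
  apply: leq_sum => i neq_i; rewrite /shift.
  case: eqP => [eq_i|_]; last by rewrite addr0.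
  by case/eqP: neq_i; apply: val_inj.
have [|||q [stack_q Hq _]] := @stackable_fill_valley p' c k stack_p' lt_k.
- rewrite /signed_walk Hp' /shift ?eqxx ?(ltnW lt_k) //.
  by move: sgn; rewrite def_e; case: (c); lia.
- rewrite /signed_walk !Hp' /shift ?eqxx ?ltn_eqF ?ek //; [|lia|lia].
  by move: sgn; rewrite def_e; case: (c); lia.
- rewrite /signed_walk !Hp' /shift ?eqxx ?gtn_eqF ?ek2 //; [|lia].
  by move: sgn; rewrite def_e; case: (c); lia.
exists q => // l le_l; have := Hq l; rewrite /shift /signed_walk Hp' // /shift.
by rewrite def_e; case: (c); case: eqP => _; lia.
Qed.

(** At a height at least 0 the valley of [p] can be filled directly.  At a height
    at most -2, the point is still below or on the axis after the move, where it is
    a valley of the opposite path, so the filling is applied to [q] and gives [p].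
    In both cases [walk_inj] identifies the result.  At height -1 the reflected
    path has the same steps before and after, and only one sign changes. *)
Lemma bruhat_fill_valley p q k : stackable p -> stackable q -> k.+2 <= n.*2 ->
  walk p k = (walk p k.+1 + 1)%R -> walk p k.+2 = (walk p k.+1 + 1)%R ->
  (forall l, l <= n.*2 -> walk q l = shift (walk p) k.+1 2 l) ->
  bruhat_le (hat p) (hat q).
Proof.
move=> stack_p stack_q le_k ek ek2 Hq.
have Hqk : walk q k = walk p k by rewrite Hq /shift ?ltn_eqF ?addr0 //; lia.
have Hqk1 : walk q k.+1 = (walk p k.+1 + 2)%R by rewrite Hq /shift ?eqxx //; lia.
have Hqk2 : walk q k.+2 = walk p k.+2 by rewrite Hq /shift ?gtn_eqF ?addr0 //; lia.
case: (ltrgtP (walk p k.+1) (-1)%R) => [lt_m1 | gt_m1 | eq_m1].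
- have [|||p' [stack_p' Hp' le_pq]] := @stackable_fill_valley q true k stack_q le_k;
    rewrite /= ?Hqk ?Hqk1 ?Hqk2; try lia.
  suff -> : p = p' by [].
  apply: walk_inj => // l le_l; have := Hp' l; rewrite /shift /signed_walk Hq // /shift.
  by case: eqP; lia.
- have [|||q' [stack_q' Hq' le_pq]] := @stackable_fill_valley p false k stack_p le_k;
    rewrite /=; try lia.
  suff -> : q = q' by [].
  by apply: walk_inj => // l le_l; rewrite Hq //; exact/esym/(Hq' l).
have half := downs_half p k.+1; have abs1 := absz_walk p k.+1.
have lt_n : downs p k.+1 < n by lia.
pose j := Ordinal lt_n; have jE : nat_of_ord j = downs p k.+1 by [].
have sg_j : sg p j by move: eq_m1; rewrite /walk -jE; case: (sg p j); lia.
have bk : downs p k = j by have := absz_walk p k; have := downs_half p k; lia.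
have bk2 : downs p k.+2 = j.+1.
  by have := absz_walk p k.+2; have := downs_half p k.+2; lia.
have eq_k : k = j.*2 by lia.
have max_j : pmax p j = j.+1.
  by have := ltn_downs p j k.+2; have := ltn_downs p j k.+1; rewrite bk2 -jE; lia.
pose r := unsign p j.
have maxr l : pmax r l = pmax p l by [].
have br l : downs r l = downs p l by [].
have stack_r : stackable r.
  split=> [i i' | l gap]; first exact: stack_p.1.
  rewrite !sg_unsign; case: (l =P j) gap => [-> | neq_l gap] /=.
    by rewrite maxr max_j ltnn.
  case: (l.+1 =P j) gap => [eq_l gap | neq_l1 gap] /=; last exact: stack_p.2.
  have lt_ln : l < n by lia.
  rewrite maxr in gap.
  by have := ltn_downs p (Ordinal lt_ln) k; rewrite /= bk; lia.
suff -> : q = r by apply: bruhat_unsign.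
apply: walk_inj => // l le_l; rewrite Hq // /shift.
have bjE : downs p l = j -> l = k \/ l = k.+1.
  by have := ltn_downs p j l; have := downs_half p l; lia.
rewrite {2}/walk br sg_unsign; case: (downs p l =P j) => [eq_b|neq_b] /=; last first.
  case: eqP => [eq_l|_]; last by rewrite addr0.
  by rewrite eq_l in neq_b.
by case: (bjE eq_b) => eq_l; rewrite eq_l ?eqxx ?ltn_eqF // ?bk; lia.
Qed.

(** By induction on the area between the two paths.  A lowest point of the lower
    path among those where the paths differ is a valley, for a neighbour that is
    even lower would also be below [q].  By parity there is room to raise it
    by 2. *)
Lemma walk_le_bruhat p q : stackable p -> stackable q ->
  (forall k, k <= n.*2 -> (walk p k <= walk q k)%R) -> bruhat_le (hat p) (hat q).
Proof.
move=> + stack_q; have path_q := walk_unit_path stack_q.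
move: {2}(\sum_(k < n.*2) absz (walk q k - walk p k)%R)
  (leqnn (\sum_(k < n.*2) absz (walk q k - walk p k)%R)) => s.
elim: s p => [|s IHs] p le_s stack_p le_pq; have path_p := walk_unit_path stack_p;
  have [p0 p2n step_p] := path_p; have [q0 q2n step_q] := path_q.
  suff -> : p = q by apply: connect0.
  apply: walk_inj => // k; rewrite leq_eqVlt => /orP[/eqP-> | lt_k].
    by rewrite p2n q2n.
  by move: le_s; have := le_pq k (ltnW lt_k); rewrite (bigD1 (Ordinal lt_k)) //=; lia.
have [/existsP[k1 lt1] | /existsPn all_eq] :=
    boolP [exists k : 'I_(n.*2), (walk p k < walk q k)%R]; last first.
  suff -> : p = q by apply: connect0.
  apply: walk_inj => // k; rewrite leq_eqVlt => /orP[/eqP-> | lt_k].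
    by rewrite p2n q2n.
  by have := le_pq k (ltnW lt_k); have := all_eq (Ordinal lt_k); rewrite /=; lia.
have [K ltK minK] := @arg_minP _ _ _ k1 (fun k : 'I_(n.*2) => walk p k < walk q k)%R
  (fun k => walk p k) lt1.
have {}minK k : k <= n.*2 -> (walk p k < walk q k)%R -> (walk p K <= walk p k)%R.
  rewrite leq_eqVlt => /orP[/eqP-> | lt_k]; first by rewrite p2n q2n.
  exact: (minK (Ordinal lt_k)).
have lt_K := ltn_ord K; move: (nat_of_ord K) lt_K ltK minK => {}K.
case: K => [|k] lt_k ltk mink; first by rewrite p0 q0 in ltk.
have lt2 : (walk p k.+1 + 2 <= walk q k.+1)%R.
  have [d def_d] := unit_path_parity path_p (ltnW lt_k).
  have [d' def_d'] := unit_path_parity path_q (ltnW lt_k).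
  lia.
have ek : walk p k = (walk p k.+1 + 1)%R.
  have := mink k; have := step_p k; have := step_q k; have := le_pq k; lia.
have ek2 : walk p k.+2 = (walk p k.+1 + 1)%R.
  have := mink k.+2; have := step_p k.+1; have := step_q k.+1; have := le_pq k.+2; lia.
have [p' stack_p' Hp'] := exists_stackable (unit_path_shift path_p lt_k ek ek2).
apply: (connect_trans (y := hat p')); first exact: (@bruhat_fill_valley p p' k).
apply: IHs => // [|l le_l]; last first.
  by rewrite Hp' // /shift; have := le_pq l le_l; case: eqP => [->|_]; lia.
rewrite -ltnS; apply: leq_trans le_s.
rewrite (bigD1 (Ordinal lt_k)) // [X in _ < X](bigD1 (Ordinal lt_k)) //=.
rewrite -addSn leq_add //.
  by rewrite Hp' /shift ?eqxx; lia.
apply: leq_sum => i neq_i; rewrite Hp' /shift; last exact: ltnW.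
case: eqP => [eq_i|_]; last by rewrite addr0.
by case/eqP: neq_i; apply: val_inj.
Qed.

End Valleys.

(** * Avoidance of the four patterns *)

Section Avoidance.

Variable n : nat.
Implicit Types (p q : signed_perm n) (i j k : 'I_n).

Lemma containsP sigma p (f : 'I_(size sigma) -> 'I_n) :
  (forall a b, [/\ (f a < f b) = (a < b),
      (mag p (f a) < mag p (f b)) = (absz (nth 0%R sigma a) < absz (nth 0%R sigma b))
    & sg p (f a) = (nth 0%R sigma a < 0)%R]) -> contains sigma p.
Proof.
move=> H; apply/existsP; exists (finfun f); apply/forallP => a; apply/forallP => b.
by have [e1 e2 e3] := H a b; rewrite !ffunE /= e1 -sgE e3 e2 !eqxx.
Qed.

(** The patterns of length 2 say that the two entries of an inversion of [|p|] have
    the same sign.  In an occurrence of 312 in [|p|] the last two entries both form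
    an inversion with the first one, so all three signs are equal and the patterns
    of length 3 exclude it. *)
Lemma avoiding_stackable p : p \in avoiding_set n patterns312 -> stackable p.
Proof.
rewrite inE => /and5P[/negP no312 /negP noN312 /negP no2N1 /negP noN21 _].
have sign_inv i j : i < j -> mag p j < mag p i -> sg p i = sg p j.
  move=> lt_ij lt_p; case sg_i: (sg p i); case sg_j: (sg p j) => //.
    case: noN21; apply: (@containsP _ p (fun a => if a == 0 :> nat then i else j)).
    by case=> -[|[|//]] ? [[|[|//]] ?] /=; split; rewrite ?sg_i ?sg_j //=; lia.
  case: no2N1; apply: (@containsP _ p (fun a => if a == 0 :> nat then i else j)).
  by case=> -[|[|//]] ? [[|[|//]] ?] /=; split; rewrite ?sg_i ?sg_j //=; lia.
have no_cab i j k : i < j -> j < k -> mag p j < mag p k -> mag p k < mag p i -> False.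
  move=> lt_ij lt_jk lt1 lt2.
  have sg_j := sign_inv i j lt_ij (ltn_trans lt1 lt2).
  have sg_k := sign_inv i k (ltn_trans lt_ij lt_jk) lt2.
  pose f (a : nat) := if a == 0 then i else if a == 1 then j else k.
  case sg_i: (sg p i); [apply: noN312 | apply: no312].
    apply: (@containsP _ p f).
    by case=> -[|[|[|//]]] ? [[|[|[|//]]] ?] /=;
      rewrite /f /=; split; rewrite -?sg_j -?sg_k ?sg_i //=; lia.
  apply: (@containsP _ p f).
  by case=> -[|[|[|//]]] ? [[|[|[|//]]] ?] /=;
      rewrite /f /=; split; rewrite -?sg_j -?sg_k ?sg_i //=; lia.
split=> [i j lt_ij lt_j | k gap].
  have [i' le_i' max_i] := pmax_attained p i.
  rewrite ltnNge; apply/negP => le_ij.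
  have neq_ij : mag p i <> mag p j by move/mag_inj => e; rewrite e ltnn in lt_ij.
  have neq_i'j : mag p i' <> mag p j by move/mag_inj => e; rewrite -e in lt_ij; lia.
  have neq_i'i : nat_of_ord i' <> i by move/val_inj => e; rewrite e in max_i; lia.
  by apply: (no_cab i' i j) => //; lia.
have [lt_k1n|le_nk1] := ltnP k.+1 n; last by have := pmax_le_n p k; lia.
pose i := Ordinal (ltnW lt_k1n); pose j := Ordinal lt_k1n.
have [i' le_i' max_i] := pmax_attained p i; rewrite /= in max_i le_i'.
have sg_max (l : 'I_n) : i' <= l -> mag p l <= mag p i' -> sg p i' = sg p l.
  move=> le_l le_m; case: (ltngtP i' l) => [lt_l|?|/val_inj-> //]; last lia.
  apply: sign_inv => //.
  case: (ltngtP (mag p l) (mag p i')) => // [?|/mag_inj e]; first lia.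
  by rewrite e ltnn in lt_l.
have sg_i : sg p i' = sg p i.
  by apply: sg_max => //; have := @ltn_pmax _ p i k (leqnn k); lia.
rewrite -[k]/(nat_of_ord i) -sg_i -[(nat_of_ord i).+1]/(nat_of_ord j).
case: (ltngtP (mag p j) (mag p i')) => [lt_j | lt_j | /mag_inj e].
- by apply: sg_max; rewrite /=; lia.
(* The entry at j is a new maximum.  As k.+1 < pmax p k, some value below the old
   maximum is still missing, and it forms an inversion with both maxima. *)
- have [l /andP[lt_kl lt_l]] : exists l : 'I_n, (k < l) && (mag p l < mag p i').
    apply/existsP; apply: contraT => /existsPn none; exfalso.
    suff : #|[set v : 'I_n | 0 <= v < pmax p k]| <= #|[set l : 'I_n | 0 <= l < k.+1]|.
      by rewrite !card_ord_range ?pmax_le_n //; lia.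
    apply: (@leq_card_perm _ p.1^-1) => v; rewrite !inE /= max_i => lt_v.
    have := none (p.1^-1%g v); rewrite negb_and -!leqNgt => /orP[] //.
    rewrite {2}/mag permKV => le_v.
    have : mag p (p.1^-1%g v) = mag p i' by rewrite {1}/mag permKV; lia.
    by move/mag_inj->.
  have lt_jl : j < l.
    rewrite ltn_neqAle lt_kl andbT; apply/eqP => /val_inj e.
    by rewrite -e in lt_l; lia.
  rewrite (sign_inv i' l) ?(sign_inv j l) //; lia.
- by rewrite -e /= in le_i'; lia.
Qed.

End Avoidance.

(** * The partition of a path *)

Lemma height0 s : height s 0 = 0%R.
Proof. by rewrite /height take0 big_nil. Qed.

Lemma heightS s k : k < size s ->
  height s k.+1 = (height s k + (if nth false s k then 1 else -1))%R.
Proof.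
by move=> lt_k; rewrite /height (take_nth false lt_k) -cats1 big_cat big_seq1.
Qed.

Lemma height_drop_take s a b l : a + l <= b -> b <= size s ->
  height (drop a (take b s)) l = (height s (a + l) - height s a)%R.
Proof.
move=> le_b le_s; rewrite /height take_drop take_takel; last lia.
rewrite [a + l]addnC -[take (l + a) s in RHS](cat_take_drop a) big_cat take_takel.
  by rewrite addrC addKr.
by lia.
Qed.

Lemma height_up_number s k : k <= size s ->
  height s k = (Posz (up_number s k).*2 - Posz k)%R.
Proof.
elim: k => [|k IHk] lt_k; first by rewrite height0 /up_number take0.
rewrite heightS // IHk 1?ltnW // /up_number (take_nth false lt_k) -cats1 count_cat /=.
by case: (nth false s k); lia.
Qed.

Lemma is_dyckP s : reflect (height s (size s) = 0%R /\
  forall k, k <= size s -> (0 <= height s k)%R) (is_dyck s).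
Proof.
apply: (iffP andP) => [[/eqP h0 /forallP h] | [h0 h]]; split => //.
- by move=> k; rewrite -ltnS => lt_k; apply: (h (Ordinal lt_k)).
- exact/eqP.
by apply/forallP => k; apply: h; rewrite -ltnS.
Qed.

(** Matched steps in terms of heights: the path between them starts and ends at the
    same height and never goes below it. *)
Lemma matchedP s i k : k < size s -> reflect
  [/\ i < k, nth false s i, ~~ nth true s k, height s k = height s i.+1
    & forall l, i < l -> l <= k -> (height s i.+1 <= height s l)%R]
  (matched s i k).
Proof.
move=> lt_k.
have sz : i < k -> size (drop i.+1 (take k s)) = k - i.+1.
  by rewrite size_drop size_takel // ltnW.
have hE : i < k -> forall l, l <= k - i.+1 ->
    height (drop i.+1 (take k s)) l = (height s (i.+1 + l) - height s i.+1)%R.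
  by move=> lt_ik l le_l; apply: height_drop_take; lia.
apply: (iffP and4P) =>
  [[lt_ik up_i down_k /is_dyckP[]] | [lt_ik up_i down_k eq_h min_h]].
  rewrite sz // hE // subnKC // => /eqP; rewrite subr_eq0 => /eqP eq_h min_h.
  split => // l lt_il le_lk; have := min_h (l - i.+1).
  by rewrite hE; [rewrite subnKC // subr_ge0; apply; lia | | lia].
split => //; apply/is_dyckP; rewrite sz //; split=> [|l le_l].
  by rewrite hE // subnKC // eq_h subrr.
by rewrite hE // subr_ge0; apply: min_h; lia.
Qed.

Lemma matched_inj s i i' k : k < size s -> matched s i k -> matched s i' k -> i = i'.
Proof.
move=> lt_k /matchedP[] // lt_ik up_i _ eq_i min_i.
case/matchedP=> // lt_i'k up_i' _ eq_i' min_i'.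
have := @heightS s i; have := @heightS s i'; rewrite up_i up_i'.
case: (ltngtP i i') => // [lt_ii' | lt_i'i].
  by have := min_i i' lt_ii'; lia.
by have := min_i' i lt_i'i; lia.
Qed.

Section PathOfPerm.

Variable n : nat.

Lemma exists_path h : unit_path n h ->
  exists P : n.*2.-tuple bool, forall k, k <= n.*2 -> height P k = h k.
Proof.
case=> h0 _ step; exists [tuple (h i < h i.+1)%R | i < n.*2].
elim=> [|k IHk] lt_k; first by rewrite height0 h0.
rewrite heightS ?size_tuple // IHk 1?ltnW //.
rewrite -[k]/(nat_of_ord (Ordinal lt_k)) -tnth_nth tnth_mktuple /=.
by have := step k lt_k; case: ltrP; lia.
Qed.

Lemma grand_dyck_unit_path (P : n.*2.-tuple bool) :
  grand_dyck P -> unit_path n (height P).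
Proof.
move=> P0; split=> [||k lt_k]; [exact: height0 | exact: P0 |].
by rewrite heightS ?size_tuple //; case: (nth _ _ _); [left | right].
Qed.

Lemma nth_reflect_path (P : n.*2.-tuple bool) x k : k < n.*2 ->
  nth x (reflect_path P) k = nth x P k (+) below P k.
Proof.
move=> lt_k; rewrite -[k]/(nat_of_ord (Ordinal lt_k)) -!tnth_nth.
by rewrite tnth_mktuple.
Qed.

Lemma height_reflect_path (P : n.*2.-tuple bool) k : k <= n.*2 ->
  height (reflect_path P) k = Posz (absz (height P k)).
Proof.
elim: k => [|k IHk] lt_k; first by rewrite !height0.
rewrite heightS ?size_tuple // IHk 1?ltnW // nth_reflect_path // /below.
rewrite heightS ?size_tuple //.
by case: (nth _ _ _); case: (ltrP (height P k) 0) => ?; case: ltrP => ? /=; lia.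
Qed.

Section Blocks.

Variables (P : n.*2.-tuple bool) (p : signed_perm n).
Hypotheses (stack_p : stackable p) (hP : forall k, k <= n.*2 -> height P k = walk p k).
Implicit Types (i j : 'I_n).

Let s := reflect_path P.

Let height_s k : k <= n.*2 -> height s k = (Posz k - Posz (downs p k).*2)%R.
Proof.
move=> le_k; rewrite height_reflect_path // hP // absz_walk.
by have := downs_half p k; lia.
Qed.

Definition down_pos i : nat := pmax p i + i.

Let ltn_down_pos i : down_pos i < n.*2.
Proof. by rewrite /down_pos; have := pmax_le_n p i; have := ltn_ord i; lia. Qed.

Lemma downs_down_pos i : downs p (down_pos i) = i /\ downs p (down_pos i).+1 = i.+1.
Proof.
have lt_in := ltn_ord i.
have step j : j < i -> down_pos j < down_pos i.
  by move=> lt_ji; rewrite /down_pos; have := pmax_homo p (ltnW lt_ji); lia.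
have step' j : i < j -> down_pos i < down_pos j.
  by move=> lt_ij; rewrite /down_pos; have := pmax_homo p (ltnW lt_ij); lia.
split; apply: downs_uniq => [|j]; try lia; rewrite -/(down_pos j).
  by case: (ltngtP j i) => [/step|/step'|/val_inj->]; lia.
by rewrite ltnS; case: (ltngtP j i) => [/step|/step'|/val_inj->]; lia.
Qed.

Let up_number_s k : k <= n.*2 -> up_number s k = k - downs p k.
Proof.
move=> le_k; have := height_s le_k; rewrite height_up_number ?size_tuple //.
by have := downs_half p k; lia.
Qed.

Let nth_s x k : k < n.*2 -> nth x s k = (downs p k.+1 == downs p k).
Proof.
move=> lt_k; rewrite (set_nth_default false) ?size_tuple //.
have := heightS (s := s) (k := k); rewrite size_tuple !height_s //; last exact: ltnW.
by case: (nth _ _ _) => /(_ lt_k); case: eqP; lia.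
Qed.

Let nth_s_down_pos x k : k < n.*2 -> ~~ nth x s k -> exists i, k = down_pos i.
Proof.
move=> lt_k; rewrite nth_s //; case: (downsS p k) => [->|[j [_ max_j _]] _].
  by rewrite eqxx.
by exists j; rewrite /down_pos max_j.
Qed.

Let nth_down_pos x i : nth x s (down_pos i) = false.
Proof. by rewrite nth_s //; have [-> ->] := downs_down_pos i; rewrite gtn_eqF. Qed.

(** Let [a] be the value popped by the [j]-th down step, and [c] the first index
    with [a < pmax p c].  The up step that pushes [a] comes after [c] down steps,
    hence has position [a + c].  The values popped at the positions [c <= x < j]
    are those in the interval from [a + 1] to [pmax p j - 1], because they lie above
    [a] on the stack; counting them shows that the path has the same height after
    the push and before the pop.  Counting only those popped up to [d] shows that
    it does not go lower in between. *)
Lemma matched_down_pos j :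
  exists2 i, matched s i (down_pos j) & up_number s i = mag p j.
Proof.
pose a := mag p j.
have [c lt_c min_c] :=
  ex_minnP (ex_intro (fun c => a < pmax p c) _ (ltn_pmax p (leqnn j))).
have le_cj : c <= j by apply: min_c; apply: ltn_pmax.
have max_le x : x < c -> pmax p x <= a.
  by move=> lt_x; rewrite leqNgt; apply/negP => /min_c; lia.
have lt_aj : a < pmax p j := ltn_pmax p (leqnn j).
have lt_jn := ltn_ord j; have lt_an : a < n := ltn_mag p j.
have stack (x : 'I_n) : c <= x -> x < j -> a < mag p x.
  move=> le_cx lt_xj; apply: stack_p.1 => //.
  by have := pmax_homo p le_cx; rewrite -/a; lia.
have b0 : downs p (a + c) = c.
  apply: downs_uniq => [|x]; first lia.
  apply/idP/idP => [lt_xc | ]; first by have := max_le x lt_xc; lia.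
  by apply: contraLR; rewrite -!leqNgt => le_cx; have := pmax_homo p le_cx; lia.
have b1 : downs p (a + c).+1 = c.
  apply: downs_uniq => [|x]; first lia.
  apply/idP/idP => [lt_xc | ]; first by have := max_le x lt_xc; lia.
  by apply: contraLR; rewrite -!leqNgt => le_cx; have := pmax_homo p le_cx; lia.
have [bj bj1] := downs_down_pos j; have lt_d := ltn_down_pos j.
have def_d : down_pos j = pmax p j + j by [].
have count_le d : c <= d -> d < j -> d.+1 - c <= pmax p d - a.+1.
  move=> le_cd lt_dj.
  suff : #|[set x : 'I_n | c <= x < d.+1]| <= #|[set v : 'I_n | a.+1 <= v < pmax p d]|.
    by rewrite !card_ord_range ?pmax_le_n //; lia.
  apply: (@leq_card_perm _ p.1) => x; rewrite !inE => /andP[le_cx lt_xd].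
  by rewrite stack //; [exact: ltn_pmax | lia].
have count_ge : pmax p j - a.+1 <= j - c.
  suff : #|[set v : 'I_n | a.+1 <= v < pmax p j]| <= #|[set x : 'I_n | c <= x < j]|.
    by rewrite !card_ord_range ?pmax_le_n //; lia.
  apply: (@leq_card_perm _ p.1^-1) => v; rewrite !inE.
  set x := (p.1^-1%g v); have -> : v = mag p x :> nat by rewrite /mag permKV.
  move=> /andP[lt_ax lt_xj]; apply/andP; split.
    by rewrite leqNgt; apply/negP => /max_le; have := ltn_pmax p (leqnn x); lia.
  case: (ltngtP x j) => // [lt_jx | /val_inj e]; last by rewrite e ltnn in lt_ax.
  by have := stack_p.1 j x lt_jx lt_xj; rewrite -/a; lia.
have count_le' : j - c <= pmax p j - a.+1.
  have [->|lt_cj] : c = j \/ c < j by lia.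
    by rewrite subnn.
  have := count_le j.-1; have := @pmax_homo _ p j.-1 j; lia.
exists (a + c); last by rewrite up_number_s ?b0; lia.
have lt_acd : a + c < down_pos j by rewrite /down_pos; lia.
apply/matchedP; rewrite ?size_tuple //; split.
- by [].
- by rewrite nth_s ?b0 ?b1 //; lia.
- by rewrite nth_down_pos.
- by rewrite !height_s ?b1 ?bj; lia.
move=> l lt_l le_l; rewrite !height_s ?b1; try lia.
have le_bl : downs p l <= j by rewrite -bj; apply: downs_homo.
have le_cb : c <= downs p l by rewrite -b1; apply: downs_homo.
have [->|lt_cb] : downs p l = c \/ c < downs p l by lia.
  by lia.
have lt_bn : (downs p l).-1 < n by lia.
have := ltn_downs p (Ordinal lt_bn) l; have := count_le (downs p l).-1.
by rewrite /=; lia.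
Qed.

(** No up step separates two down steps iff the numbers of up steps before them
    are equal. *)
Lemma same_run_down_pos (t t' : 'I_(n.*2)) i j :
  t = down_pos i :> nat -> t' = down_pos j :> nat ->
  same_run s t t' = (pmax p i == pmax p j).
Proof.
wlog le_ij : t t' i j / i <= j.
  move=> W def_t def_t'; case: (leqP i j) => [|/ltnW] le_ij; first exact: W.
  rewrite eq_sym -(W t' t j i) //; rewrite /same_run; apply: eq_forallb => l.
  by rewrite minnC maxnC.
move=> def_t def_t'; have le_max := pmax_homo p le_ij.
have le_tt' : t <= t' by rewrite def_t def_t' /down_pos; lia.
rewrite /same_run (minn_idPl le_tt') (maxn_idPr le_tt').
have [bi bi1] := downs_down_pos i; have [bj bj1] := downs_down_pos j.
apply/forallP/eqP => [down | eq_max l].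
  have bE d : t + d <= t' -> downs p (t + d) = i + d.
    elim: d => [|d IHd] le_d; first by rewrite !addn0 def_t.
    have lt_d : t + d < n.*2 by have := ltn_ord t'; lia.
    have := down (Ordinal lt_d); rewrite (tnth_nth false) /= leq_addr /=.
    have -> : t + d <= t' by lia.
    rewrite nth_s // !addnS => down_d.
    have {}IHd : downs p (t + d) = i + d by apply: IHd; lia.
    move: down_d.
    case: (downsS p (t + d)) => [->|[x [eq_x _ ->]]]; first by rewrite eqxx.
    by rewrite -eq_x IHd.
  have := bE (t' - t); rewrite subnKC // def_t' bj => /(_ (leqnn _)).
  by move: le_tt'; rewrite def_t def_t' /down_pos; lia.
apply/implyP; rewrite (tnth_nth false) def_t def_t' => /andP[le_tl le_lt'].
have lt_n : l - pmax p i < n.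
  by move: le_lt'; rewrite /down_pos -eq_max; have := ltn_ord j; lia.
have def_l : l = down_pos (Ordinal lt_n) :> nat.
  rewrite /down_pos /=; have := @pmax_homo _ p i (l - pmax p i).
  have := @pmax_homo _ p (l - pmax p i) j; move: le_tl le_lt'.
  by rewrite /down_pos -eq_max; lia.
by rewrite def_l nth_down_pos.
Qed.

Definition plateau j : {set 'I_n} := [set p.1 k | k : 'I_n & pmax p k == pmax p j].

Lemma run_block_down_pos (t : 'I_(n.*2)) j :
  t = down_pos j :> nat -> run_block s t = plateau j.
Proof.
move=> def_t; apply/setP => u; rewrite inE; apply/existsP/imsetP.
  case=> i /existsP[k /and3P[run_k mat_k /eqP up_i]].
  have /matchedP := mat_k; rewrite size_tuple ltn_ord => /(_ isT)[_ _ down_k _ _].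
  have [j' def_k] := nth_s_down_pos (ltn_ord k) down_k.
  exists j'; first by rewrite inE eq_sym -(same_run_down_pos def_t def_k).
  have [i' mat_i' up_i'] := matched_down_pos j'.
  apply: val_inj; transitivity (mag p j'); last by [].
  rewrite -up_i' -[LHS]up_i; congr (up_number _ _).
  by apply: matched_inj mat_k _; rewrite ?size_tuple ?def_k.
case=> j'; rewrite inE => eq_max ->.
have [i mat_i up_i] := matched_down_pos j'.
have lt_i : i < n.*2.
  have /matchedP := mat_i; rewrite size_tuple ltn_down_pos => /(_ isT)[].
  by have := ltn_down_pos j'; lia.
exists (Ordinal lt_i); apply/existsP; exists (Ordinal (ltn_down_pos j')).
rewrite (@same_run_down_pos _ _ j j') // eq_sym eq_max mat_i /= up_i; exact: eqxx.
Qed.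

(** A down step of the reflected path starts at a positive height, so it comes from
    a step below the axis iff the sign is negative. *)
Lemma below_down_pos j : below P (down_pos j) = sg p j.
Proof.
have lt_d := ltn_down_pos j; have [bj bj1] := downs_down_pos j.
rewrite /below !hP //; last exact: ltnW.
have [_ _ /(_ _ lt_d)] := walk_unit_path stack_p.
have def_d : down_pos j = pmax p j + j by [].
have : walk p (down_pos j) = if sg p j then (Posz j.*2 - Posz (down_pos j))%R
    else (Posz (down_pos j) - Posz j.*2)%R by rewrite /walk bj.
have := ltn_pmax_pos p j.
by case: (sg p j); case: (ltrP (walk p (down_pos j)) 0) => ?; case: ltrP => ? //=; lia.
Qed.

Lemma path_partitionE :
  path_partition P = ([set plateau j | j : 'I_n], [set plateau j | j : 'I_n & sg p j]).
Proof.
congr (_, _); apply/setP => B; apply/imsetP/imsetP => -[t].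
- rewrite inE (tnth_nth false) => down_t ->.
  have [j def_t] := nth_s_down_pos (ltn_ord t) down_t.
  by exists j; rewrite // (run_block_down_pos def_t).
- move=> _ ->; exists (Ordinal (ltn_down_pos t)).
    by rewrite inE (tnth_nth false) nth_down_pos.
  by rewrite (@run_block_down_pos _ t).
- rewrite inE (tnth_nth false) => /andP[down_t below_t] ->.
  have [j def_t] := nth_s_down_pos (ltn_ord t) down_t.
  exists j; first by rewrite inE -below_down_pos -def_t.
  by rewrite (run_block_down_pos def_t).
rewrite inE => sg_t ->; exists (Ordinal (ltn_down_pos t)).
  by rewrite inE (tnth_nth false) nth_down_pos below_down_pos.
by rewrite (@run_block_down_pos _ t).
Qed.

End Blocks.
End PathOfPerm.

(** * The coloured noncrossing partition of a stackable signed permutation *)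

Lemma in_bigcup_seq (T : finType) (r : seq {set T}) x :
  (x \in \bigcup_(A <- r) A) = has (fun A : {set T} => x \in A) r.
Proof. by elim: r => [|A r IHr]; rewrite ?big_nil ?big_cons !inE ?IHr. Qed.

Section PartitionOfPerm.

Variables (n : nat) (p : signed_perm n).
Hypothesis stack_p : stackable p.
Implicit Types (i j k : 'I_n) (A B : {set 'I_n}).

Definition plateaus : {set {set 'I_n}} := [set plateau p j | j : 'I_n].
Definition coloured_plateaus : {set {set 'I_n}} :=
  [set plateau p j | j : 'I_n & sg p j].

Lemma mem_plateau k j : (p.1 k \in plateau p j) = (pmax p k == pmax p j).
Proof.
apply/imsetP/eqP => [[k' + /perm_inj->] | eq_max]; first by rewrite inE => /eqP.
by exists k; rewrite ?inE ?eq_max.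
Qed.

Lemma in_plateaus j : plateau p j \in plateaus.
Proof. exact: imset_f. Qed.

Lemma perm_surj (v : 'I_n) : exists k, v = p.1 k.
Proof. by exists (p.1^-1%g v); rewrite permKV. Qed.

Lemma eq_plateau i j : pmax p i = pmax p j -> plateau p i = plateau p j.
Proof. by move=> e; rewrite /plateau e. Qed.

Lemma plateaus_partition : partition plateaus [set: 'I_n].
Proof.
apply/and3P; split.
- rewrite eqEsubset subsetT; apply/subsetP => v _; have [k ->] := perm_surj v.
  by apply/bigcupP; exists (plateau p k); rewrite ?in_plateaus ?mem_plateau.
- apply/trivIsetP => _ _ /imsetP[i _ ->] /imsetP[j _ ->] neq_ij.
  apply/pred0P => v /=; have [k ->] := perm_surj v; apply/negP => /andP[].
  by rewrite !mem_plateau => /eqP-> /eqP/eq_plateau/eqP; rewrite (negPf neq_ij).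
apply/negP => /imsetP[j _ /setP/(_ (p.1 j))].
by rewrite in_set0 mem_plateau eqxx.
Qed.

(** Four crossing values would give two positions [k < l] such that the value at
    [l] is greater than the value at [k] but had been pushed before the latter was
    popped. *)
Lemma plateaus_noncrossing : noncrossing plateaus.
Proof.
move=> _ _ a b c d /imsetP[i _ ->] /imsetP[j _ ->] lt_ab lt_bc lt_cd.
have [ka def_a] := perm_surj a; have [kb def_b] := perm_surj b.
have [kc def_c] := perm_surj c; have [kd def_d] := perm_surj d.
have magE k (v : 'I_n) : v = p.1 k -> v = mag p k :> nat by move->.
rewrite (magE ka) // (magE kb) // in lt_ab; rewrite (magE kb) // (magE kc) // in lt_bc.
rewrite (magE kc) // (magE kd) // in lt_cd.
rewrite def_a def_b def_c def_d !mem_plateau => /eqP ma /eqP mc /eqP mb /eqP md.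
have pos_lt k l : pmax p k < pmax p l -> k < l.
  by rewrite !ltnNge; apply: contra; apply: pmax_homo.
case: (ltngtP (pmax p i) (pmax p j)) => [lt_m|gt_m|/eq_plateau //].
  have lt_k : ka < kb by apply: pos_lt; lia.
  have := stack_p.1 ka kb lt_k; have := ltn_pmax p (leqnn kc); lia.
have lt_k : kb < kc by apply: pos_lt; lia.
have := stack_p.1 kb kc lt_k; have := ltn_pmax p (leqnn kd); lia.
Qed.

Lemma block_max_plateau j : (block_max (plateau p j)).+1 = pmax p j.
Proof.
apply/eqP; rewrite eqn_leq; apply/andP; split.
  have [k le_k def_max] := pmax_attained p j.
  rewrite def_max ltnS; apply/bigmax_leqP => v; have [k' ->] := perm_surj v.
  rewrite mem_plateau => /eqP eq_max; rewrite -/(mag p k') -ltnS -def_max -eq_max.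
  exact: ltn_pmax.
have [k le_k def_max] := pmax_attained p j.
have kB : p.1 k \in plateau p j.
  by rewrite mem_plateau eqn_leq pmax_homo //= def_max; exact: ltn_pmax.
by rewrite def_max ltnS; apply: (bigop.bigmax_sup (p.1 k)).
Qed.

Lemma block_max_inj : {in plateaus &, injective (@block_max n)}.
Proof.
move=> _ _ /imsetP[i _ ->] /imsetP[j _ ->] eq_max; apply: eq_plateau.
by rewrite -!block_max_plateau eq_max.
Qed.

Lemma mem_standard_form A : (A \in standard_form plateaus) = (A \in plateaus).
Proof. by rewrite mem_sort mem_enum. Qed.

Lemma standard_form_sorted :
  pairwise (fun A B => block_max A < block_max B) (standard_form plateaus).
Proof.
suff : sorted ltn (map (@block_max n) (standard_form plateaus)).
  by rewrite sorted_pairwise ?pairwise_map //; apply: ltn_trans.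
rewrite ltn_sorted_uniq_leq map_inj_in_uniq; last first.
  by move=> A B; rewrite !mem_standard_form; apply: block_max_inj.
rewrite sort_uniq enum_uniq sorted_map; apply: sort_sorted => A B.
exact: leq_total.
Qed.

Lemma sg_same_plateau i j : pmax p i = pmax p j -> sg p i = sg p j.
Proof.
wlog le_ij : i j / i <= j.
  by move=> W eq_max; case: (leqP i j) => [|/ltnW] le; [|apply/esym]; apply: W.
move=> eq_max; apply: sg_constant_off_axis => // k le_ik lt_kj.
by have := pmax_homo p le_ik; have := ltn_pmax_pos p j; lia.
Qed.

Lemma mem_coloured_plateaus j : (plateau p j \in coloured_plateaus) = sg p j.
Proof.
apply/imsetP/idP => [[k] | sg_j]; last by exists j; rewrite ?inE.
rewrite inE => sg_k eq_plateau; rewrite (@sg_same_plateau j k) //.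
by rewrite -!block_max_plateau eq_plateau.
Qed.

Lemma mem_cover_coloured j : (p.1 j \in cover coloured_plateaus) = sg p j.
Proof.
apply/bigcupP/idP => [[_ /imsetP[k + ->]] | sg_j].
  by rewrite inE mem_plateau => sg_k /eqP/sg_same_plateau->.
by exists (plateau p j); rewrite ?mem_coloured_plateaus ?mem_plateau.
Qed.

Lemma mem_bigcup_filter (P : pred nat) k :
  (p.1 k \in \bigcup_(A <- [seq A <- standard_form plateaus | P (block_max A).+1]) A)
  = P (pmax p k).
Proof.
rewrite in_bigcup_seq; apply/hasP/idP => [[A] | Pk].
  rewrite mem_filter mem_standard_form => /andP[/[swap] /imsetP[j _ ->]].
  by by rewrite block_max_plateau mem_plateau => Pj /eqP->.
exists (plateau p k); last by rewrite mem_plateau eqxx.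
by rewrite mem_filter mem_standard_form in_plateaus block_max_plateau Pk.
Qed.

(** When the path visits the axis after the [i]-th down step, the blocks read up to
    this step fill the interval [0, i], and the other blocks its complement. *)
Lemma axis_splitting i : pmax p i = i.+1 -> i.+1 < n ->
  interval_splitting plateaus
    [:: [seq A <- standard_form plateaus | (block_max A).+1 <= i.+1];
        [seq A <- standard_form plateaus | i.+1 < (block_max A).+1]].
Proof.
move=> axis lt_in.
have max_le k : (pmax p k <= i.+1) = (mag p k <= i).
  rewrite (pmax_axis k axis).
  apply/idP/idP => [|le_ki]; last by rewrite -axis pmax_homo.
  by have := ltn_pmax_pos p k; lia.
split.
  rewrite /= cats0; apply: (@irr_sorted_eq _ (fun A B => block_max A < block_max B)).
  - by move=> A B C; apply: ltn_trans.
  - by move=> A; apply: ltnn.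
  - rewrite sorted_pairwise; last by move=> A B C; apply: ltn_trans.
    rewrite pairwise_cat !pairwise_filter ?standard_form_sorted // !andbT.
    by apply/allrelP => A B; rewrite !mem_filter => /andP[le_A _] /andP[lt_B _]; lia.
  - rewrite sorted_pairwise ?standard_form_sorted //.
    by move=> A B C; apply: ltn_trans.
  by move=> A; rewrite mem_cat !mem_filter -andb_orl leqNgt orNb.
move=> S; rewrite !inE => /orP[] /eqP->; split.
- move=> nil1; have : plateau p i \in [::]; last by [].
  by rewrite -nil1 mem_filter mem_standard_form in_plateaus block_max_plateau axis leqnn.
- move=> u v w; have [ku ->] := perm_surj u; have [kv ->] := perm_surj v.
  have [kw ->] := perm_surj w.
  rewrite !(mem_bigcup_filter (fun m => m <= i.+1)) !max_le /mag.
  by move=> _ le_w /andP[_ le_vw]; apply: leq_trans le_w.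
- move=> nil2; have : plateau p (Ordinal lt_in) \in [::]; last by [].
  by rewrite -nil2 mem_filter mem_standard_form in_plateaus block_max_plateau andbT;
    exact: (ltn_pmax_pos p (Ordinal lt_in)).
move=> u v w; have [ku ->] := perm_surj u; have [kv ->] := perm_surj v.
  have [kw ->] := perm_surj w.
rewrite !(mem_bigcup_filter (fun m => i.+1 < m)) !ltnNge !max_le /mag.
by move=> lt_u _ /andP[le_uv _]; apply: contra lt_u; apply: leq_trans.
Qed.

(** The finest splitting refines those of [axis_splitting].  So there is no visit to
    the axis between two blocks of one component, and their signs agree. *)
Lemma components_sg ss S i j : components plateaus ss -> S \in ss ->
  plateau p i \in S -> plateau p j \in S -> i <= j -> sg p i = sg p j.
Proof.
move=> [_ finest] S_ss iS jS le_ij.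
have [/existsP[k /and3P[le_ik lt_kj /eqP axis]] | /existsPn gap] :=
    boolP [exists k : 'I_n, [&& i <= k, k < j & pmax p k == k.+1]]; last first.
  apply: sg_constant_off_axis => // k le_ik lt_kj.
  have lt_kn : k < n by have := ltn_ord j; lia.
  have := gap (Ordinal lt_kn); have := ltn_pmax_pos p (Ordinal lt_kn).
  by rewrite /= le_ik lt_kj; lia.
have lt_kn : k.+1 < n by have := ltn_ord j; lia.
(* a visit to the axis at k, between i and j, would separate their blocks *)
have [uu [def_ss]] := finest _ (axis_splitting axis lt_kn).
case: uu def_ss => [|u1 [|u2 [|? ?]]] //= def_ss [def_u1 def_u2].
move: S_ss; rewrite -def_ss cats0 mem_cat => /orP[S_u|S_u].
  have : plateau p j \in flatten u1 by apply/flattenP; exists S.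
  rewrite def_u1 mem_filter block_max_plateau => /andP[le_jk _].
  by have := ltn_pmax_pos p j; lia.
have : plateau p i \in flatten u2 by apply/flattenP; exists S.
rewrite def_u2 mem_filter block_max_plateau => /andP[lt_ki _].
by have := pmax_homo p le_ik; lia.
Qed.

Lemma plateaus_coloured_nc : coloured_nc (plateaus, coloured_plateaus).
Proof.
split => /=; [exact: plateaus_partition | exact: plateaus_noncrossing | |].
  by apply/subsetP => _ /imsetP[j _ ->]; apply: in_plateaus.
move=> ss S comp_ss S_ss.
have in_S A : A \in S -> exists j, A = plateau p j.
  move=> A_S; have : A \in plateaus.
    have [[def_ss _] _] := comp_ss; rewrite -mem_standard_form -def_ss.
    by apply/flattenP; exists S.
  by case/imsetP => j _ ->; exists j.
have [/allP all_col | /allPn[A A_S A_nc]] := boolP (all (mem coloured_plateaus) S).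
  by left=> A A_S; apply: all_col.
right=> B B_S; move: A_nc; have [i def_A] := in_S A A_S; have [j def_B] := in_S B B_S.
rewrite /= def_A def_B !mem_coloured_plateaus.
rewrite def_A in A_S; rewrite def_B in B_S.
case: (leqP i j) => [|/ltnW] le; first by rewrite (components_sg comp_ss S_ss A_S B_S).
by rewrite (components_sg comp_ss S_ss B_S A_S).
Qed.

Lemma enum_ord_sorted (A : {set 'I_n}) : pairwise (fun i j => i < j) (enum A).
Proof.
rewrite /enum_mem pairwise_filter // -enumT.
rewrite -(pairwise_map (@nat_of_ord n) ltn) val_enum_ord -sorted_pairwise.
  exact: iota_ltn_sorted.
exact: ltn_trans.
Qed.

(** Both words list all values in increasing order for the same strict order [R]:
    first compare the maxima of the blocks, then, inside a block, decreasing values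
    come first. *)
Lemma standard_word_plateaus : standard_word plateaus = [seq p.1 i | i <- enum 'I_n].
Proof.
pose m (v : 'I_n) := pmax p (p.1^-1%g v).
have mE k : m (p.1 k) = pmax p k by rewrite /m permK.
pose R (u v : 'I_n) := (m u < m v) || (m u == m v) && (v < u).
have R_trans : transitive R by move=> u v w; rewrite /R; lia.
apply: (@irr_sorted_eq _ R) => //; first by move=> u; rewrite /R; lia.
- rewrite sorted_pairwise // /standard_word.
  have : {subset standard_form plateaus <= plateaus}.
    by move=> A; rewrite mem_standard_form.
  elim: (standard_form plateaus) standard_form_sorted => //= A r IHr.
  move=> /andP[/allP lt_A sorted_r] sub; rewrite pairwise_cat IHr // ?andbT; last first.
    by move=> B B_r; apply: sub; rewrite inE B_r orbT.
  have mA B u : B \in A :: r -> u \in B -> m u = (block_max B).+1.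
    move=> /sub/imsetP[j _ ->]; have [k ->] := perm_surj u.
    by rewrite mem_plateau mE block_max_plateau => /eqP.
  apply/andP; split.
    apply/allrelP => u v; rewrite mem_rev mem_enum => u_A /flattenP[_ /mapP[B B_r ->]].
    rewrite mem_rev mem_enum => v_B; rewrite /R (mA A) ?(mA B) ?inE ?eqxx ?B_r ?orbT //.
    by rewrite ltnS lt_A.
  rewrite -sorted_pairwise // rev_sorted.
  apply: (@sub_in_sorted _ (mem A) (fun i j => i < j)).
  - move=> u v u_A v_A lt_uv; rewrite /R (mA A v) ?(mA A u) ?inE ?eqxx //.
    by rewrite lt_uv orbT.
  - by apply/allP => u; rewrite mem_enum.
  by rewrite sorted_pairwise ?enum_ord_sorted // => u v w; apply: ltn_trans.
- apply: (@homo_sorted _ _ _ (fun i j => i < j)).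
    move=> i j lt_ij; rewrite /R !mE.
    have := pmax_homo p (ltnW lt_ij); have := stack_p.1 i j lt_ij.
    have := ltn_pmax p (leqnn j); rewrite -/(mag p i) -/(mag p j); lia.
  rewrite -(sorted_map (f := @nat_of_ord n) (e' := ltn)) val_enum_ord.
  exact: iota_ltn_sorted.
move=> u; have [k ->] := perm_surj u; rewrite map_f ?mem_enum //.
apply/flattenP; exists (rev (enum (plateau p k))).
  by apply: map_f; rewrite mem_standard_form in_plateaus.
by rewrite mem_rev mem_enum mem_plateau.
Qed.

Lemma bar_removal_plateaus : bar_removal (plateaus, coloured_plateaus) p.
Proof.
rewrite /bar_removal standard_word_plateaus -[RHS]map_comp; apply: eq_map => i /=.
by rewrite /entry mem_cover_coloured sgE.
Qed.

End PartitionOfPerm.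

(** * The isomorphism *)

Lemma signed_perm_eq n (p q : signed_perm n) :
  (forall i, entry p i = entry q i) -> p = q.
Proof.
move=> eq_entry; rewrite [p]surjective_pairing [q]surjective_pairing; congr (_, _).
  by apply/permP => i; case: (eq_entry i).
by apply/ffunP => i; case: (eq_entry i).
Qed.

Lemma bar_removal_inj n (X : coloured_partition n) (p q : signed_perm n) :
  bar_removal X p -> bar_removal X q -> p = q.
Proof.
rewrite /bar_removal => <- /eq_in_map eq_entry.
by apply: signed_perm_eq => i; rewrite eq_entry ?mem_enum.
Qed.

Lemma hat_inj n : injective (@hat n).
Proof.
move=> p q eq_hat; apply: signed_perm_eq => i.
have /permP/(_ (true, rev_ord i)) := eq_hat.
by rewrite !hatE /hat_fun /= rev_ordK.
Qed.

Lemma stackable_path_partition n (P : n.*2.-tuple bool) (p : signed_perm n) :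
  stackable p -> (forall k, k <= n.*2 -> height P k = walk p k) ->
  coloured_nc (path_partition P) /\ bar_removal (path_partition P) p.
Proof.
move=> stack_p heightP; rewrite (path_partitionE stack_p heightP).
by split; [apply: plateaus_coloured_nc | apply: bar_removal_plateaus].
Qed.

Theorem theorem3p1 (n : nat) (n_ge1 : 1 <= n) :
  poset_isomorphic
    (avoiding_set n patterns312) (@signed_perm_le n)
    [set hat p | p in avoiding_set n patterns312] (fun s t => bruhat_le s t).
Proof.
exists (@hat n); split=> // [p q _ _ /hat_inj // | p q p_av q_av].
have stack_p := avoiding_stackable p_av; have stack_q := avoiding_stackable q_av.
split=> [[X [Y [_ _ Xp Yq [P [Q [dyckP dyckQ defX defY le_PQ]]]]]] | le_pq].
  have walkE (R : n.*2.-tuple bool) Z (r : signed_perm n) :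
      grand_dyck R -> path_partition R = Z -> bar_removal Z r ->
      forall k, k <= n.*2 -> walk r k = height R k.
    move=> dyckR defZ Zr.
    have [r' stack_r' walk_r'] := exists_stackable (grand_dyck_unit_path dyckR).
    suff -> : r = r' by [].
    apply: bar_removal_inj Zr _; rewrite -defZ.
    by apply: (stackable_path_partition stack_r' _).2 => k le_k; rewrite walk_r'.
  have walk_p := walkE P X p dyckP defX Xp.
  have walk_q := walkE Q Y q dyckQ defY Yq.
  by apply: walk_le_bruhat => // k le_k; rewrite walk_p ?walk_q //; apply: le_PQ.
have [P heightP] := exists_path (walk_unit_path stack_p).
have [Q heightQ] := exists_path (walk_unit_path stack_q).
have [ncP Pp] := stackable_path_partition stack_p heightP.
have [ncQ Qq] := stackable_path_partition stack_q heightQ.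
exists (path_partition P), (path_partition Q); split => //.
have dyck (R : n.*2.-tuple bool) (r : signed_perm n) : stackable r ->
    (forall k, k <= n.*2 -> height R k = walk r k) -> grand_dyck R.
  by move=> /walk_unit_path[_ walk0 _] heightR; rewrite /grand_dyck heightR ?walk0.
exists P, Q; split => //; [exact: (dyck P p) | exact: (dyck Q q) | move=> k le_k].
by rewrite heightP // heightQ //; apply: bruhat_walk_homo.
Qed.
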